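(* For every $k\ge 2$, the ring $R_k/I_k$ is Cohen-Macaulay.
   Context: $\mathbb F$ is a field of characteristic $\neq 2$. For $k\ge 2$, $R_k$ is the polynomial ring over $\mathbb F$ in the $3k$ variables $v_{i,c}$ ($1\le i\le k$, $c=1,2,3$), and $\overline v_i=(v_{i,1},v_{i,2},v_{i,3})\in R_k^3$. Let $S=\mathrm{diag}(-1,-1,1)$ and let $a\times b=(a_2b_3-a_3b_2,\;a_3b_1-a_1b_3,\;a_1b_2-a_2b_1)$ be the cross product. Define recursively $\overline w_2=\overline v_1\times\overline v_2$ and $\overline w_j=S(\overline w_{j-1})\times\overline v_j$ for $j\ge 3$. $I_k\subset R_k$ is the ideal generated by the three components of $\overline w_k$. *)

(* Defs.v *)
From HB Require Import structures.
From mathcomp Require Import all_boot all_algebra.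
From mathcomp Require Import generic_quotient ring_quotient.
From mathcomp Require Import boolp.
From mathcomp Require Import ring.
From mathcomp Require Import mpoly.

Set Implicit Arguments.
Unset Strict Implicit.
Unset Printing Implicit Defensive.

Import GRing.Theory.
Local Open Scope ring_scope.
Local Open Scope quotient_scope.

(* Localization of A at the prime ideal P: fractions a/s with s \notin P,
   where a/s = b/t iff u (a t) = u (b s) for some u \notin P. *)
Module Localization.
Section Localization.
Variables (A : comNzRingType) (P : prime_idealr A).

Definition den := {s : A | s \notin P}.
Local Notation frac := (A * den)%type.

Implicit Types x y z : frac.

Lemma den1_subproof : (1 : A) \notin P.
Proof. by rewrite idealr1. Qed.
Definition den1 : den := Sub 1 den1_subproof.

Lemma denM_subproof (s t : den) : sval s * sval t \notin P.
Proof. by rewrite prime_idealrM negb_or (valP s) (valP t). Qed.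
Definition denM (s t : den) : den := Sub (sval s * sval t) (denM_subproof s t).

Definition equivl x y : bool :=
  `[< exists u : den, sval u * (x.1 * sval y.2) = sval u * (y.1 * sval x.2) >].

Lemma equivl_refl : reflexive equivl.
Proof. by move=> x; apply/asboolP; exists den1. Qed.

Lemma equivl_sym : ssrbool.symmetric equivl.
Proof. by move=> x y; apply/asboolP/asboolP => -[u e]; exists u. Qed.

Lemma equivl_trans : transitive equivl.
Proof.
move=> y x z /asboolP[u e] /asboolP[v f]; apply/asboolP.
exists (denM (denM u v) y.2) => /=.
transitivity (sval v * sval z.2 * (sval u * (x.1 * sval y.2))); first by ring.
rewrite e.
transitivity (sval u * sval x.2 * (sval v * (y.1 * sval z.2))); first by ring.
by rewrite f; ring.
Qed.

Canonical equivl_equiv := EquivRel equivl equivl_refl equivl_sym equivl_trans.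

Definition type := {eq_quot equivl}.

HB.instance Definition _ : EqQuotient _ equivl type := EqQuotient.on type.
HB.instance Definition _ := Choice.on type.

Lemma equivl_repr x :
  exists u : den, sval u * ((repr (\pi_type x)).1 * sval x.2)
                = sval u * (x.1 * sval (repr (\pi_type x)).2).
Proof. by apply/asboolP; rewrite -/(equivl _ _) -eqmodE reprK. Qed.

Definition addf x y : frac :=
  (x.1 * sval y.2 + y.1 * sval x.2, denM x.2 y.2).
Definition oppf x : frac := (- x.1, x.2).
Definition mulf x y : frac := (x.1 * y.1, denM x.2 y.2).

Definition add := lift_op2 type addf.
Definition opp := lift_op1 type oppf.
Definition mul := lift_op2 type mulf.
Definition zero := lift_cst type ((0, den1) : frac).
Definition one := lift_cst type ((1, den1) : frac).

Canonical pi_zero_morph := PiConst zero.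
Canonical pi_one_morph := PiConst one.

Lemma pi_add : {morph \pi : x y / addf x y >-> add x y}.
Proof.
move=> x y; unlock add; apply/eqmodP/asboolP => /=.
have [u e] := equivl_repr x; have [v f] := equivl_repr y.
move: (repr _) (repr _) e f => y' x' /= e f.
exists (denM u v) => /=.
transitivity (sval v * sval y.2 * sval y'.2 * (sval u * (x.1 * sval x'.2))
            + sval u * sval x.2 * sval x'.2 * (sval v * (y.1 * sval y'.2))).
  by ring.
by rewrite -e -f; ring.
Qed.
Canonical pi_add_morph := PiMorph2 pi_add.

Lemma pi_opp : {morph \pi : x / oppf x >-> opp x}.
Proof.
move=> x; unlock opp; apply/eqmodP/asboolP => /=.
have [u e] := equivl_repr x; exists u => /=.
by rewrite !mulNr !mulrN e.
Qed.
Canonical pi_opp_morph := PiMorph1 pi_opp.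

Lemma pi_mul : {morph \pi : x y / mulf x y >-> mul x y}.
Proof.
move=> x y; unlock mul; apply/eqmodP/asboolP => /=.
have [u e] := equivl_repr x; have [v f] := equivl_repr y.
move: (repr _) (repr _) e f => y' x' /= e f.
exists (denM u v) => /=.
transitivity ((sval u * (x.1 * sval x'.2)) * (sval v * (y.1 * sval y'.2))).
  by ring.
by rewrite -e -f; ring.
Qed.
Canonical pi_mul_morph := PiMorph2 pi_mul.

Lemma addA : associative add.
Proof.
elim/quotW=> x; elim/quotW=> y; elim/quotW=> z; rewrite !piE.
by apply/eqmodP/asboolP; exists den1 => /=; ring.
Qed.

Lemma addC : commutative add.
Proof.
elim/quotW=> x; elim/quotW=> y; rewrite !piE.
by apply/eqmodP/asboolP; exists den1 => /=; ring.
Qed.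

Lemma add0l : left_id zero add.
Proof.
elim/quotW=> x; rewrite !piE.
by apply/eqmodP/asboolP; exists den1 => /=; ring.
Qed.

Lemma addNl : left_inverse zero opp add.
Proof.
elim/quotW=> x; rewrite !piE.
by apply/eqP; rewrite piE; apply/asboolP; exists den1 => /=; ring.
Qed.

HB.instance Definition _ := GRing.isZmodule.Build type addA addC add0l addNl.

Lemma mulA : associative mul.
Proof.
elim/quotW=> x; elim/quotW=> y; elim/quotW=> z; rewrite !piE.
by apply/eqmodP/asboolP; exists den1 => /=; ring.
Qed.

Lemma mulC : commutative mul.
Proof.
elim/quotW=> x; elim/quotW=> y; rewrite !piE.
by apply/eqmodP/asboolP; exists den1 => /=; ring.
Qed.

Lemma mul1l : left_id one mul.
Proof.
elim/quotW=> x; rewrite !piE.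
by apply/eqmodP/asboolP; exists den1 => /=; ring.
Qed.

Lemma mulDl : left_distributive mul add.
Proof.
elim/quotW=> x; elim/quotW=> y; elim/quotW=> z; rewrite !piE.
by apply/eqmodP/asboolP; exists den1 => /=; ring.
Qed.

Lemma one_neq0 : one != zero.
Proof.
rewrite !piE; apply/asboolP => -[u] /=.
rewrite !mul0r !mulr1 mulr0 => u0.
by have := valP u; rewrite /= u0 idealr0.
Qed.

HB.instance Definition _ :=
  GRing.Zmodule_isComNzRing.Build type mulA mulC mul1l mulDl one_neq0.

End Localization.
End Localization.
HB.export Localization.

Definition localization (A : comNzRingType) (P : prime_idealr A) :
  comNzRingType := Localization.type P.

Section CohenMacaulay.
Variable A : comNzRingType.

Definition ideal_gen (s : seq A) : {pred A} :=
  fun x => `[< exists c : 'I_(size s) -> A, x = \sum_i c i * s`_i >].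

(* [idealr A] consists of the proper ideals; the unit ideal is generated by 1. *)
Definition noetherian : Prop :=
  forall I : idealr A, exists s : seq A, I =i ideal_gen s.

Definition maximal (m : idealr A) : Prop :=
  forall J : idealr A, {subset m <= J} -> {subset J <= m}.

Definition prime_chain (n : nat) (p : 'I_n.+1 -> prime_idealr A) : Prop :=
  forall i j : 'I_n.+1, (i < j)%N ->
    {subset p i <= p j} /\ ~ {subset p j <= p i}.

Definition has_krull_dim (d : nat) : Prop :=
  (exists p : 'I_d.+1 -> prime_idealr A, prime_chain p) /\
  (forall n (p : 'I_n.+1 -> prime_idealr A), prime_chain p -> (n <= d)%N).

(* The second clause says that s_i is a nonzerodivisor on
   A / (s_0, ..., s_(i-1)). *)
Definition regular_seq (s : seq A) : Prop :=
  1 \notin ideal_gen s /\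
  forall i, (i < size s)%N -> forall x,
    s`_i * x \in ideal_gen (take i s) -> x \in ideal_gen (take i s).

Definition has_depth (m : idealr A) (d : nat) : Prop :=
  (exists s, [/\ size s = d, {subset s <= m} & regular_seq s]) /\
  (forall s, {subset s <= m} -> regular_seq s -> (size s <= d)%N).

Definition CM_local : Prop :=
  exists (m : idealr A) (d : nat),
    [/\ maximal m, forall m' : idealr A, maximal m' -> m' =i m,
        has_krull_dim d & has_depth m d].

End CohenMacaulay.

Arguments noetherian : clear implicits.
Arguments has_krull_dim : clear implicits.
Arguments CM_local : clear implicits.

(* Maximal ideals are prime, so quantifying over the prime ideals P that are
   maximal covers every maximal ideal. *)
Definition cohen_macaulay (A : comNzRingType) : Prop :=
  noetherian A /\
  forall P : prime_idealr A, maximal P -> CM_local (localization P).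

Section CrossProducts.
Variable R : comNzRingType.
Implicit Types a b : 'rV[R]_3.

Definition row3 (x y z : R) : 'rV[R]_3 := \row_(c < 3) [:: x; y; z]`_c.

(* Components a_1, a_2, a_3 are a 0 0, a 0 1, a 0 2. *)
Definition crossmul a b : 'rV[R]_3 :=
  row3 (a 0 1 * b 0 2 - a 0 2 * b 0 1)
       (a 0 2 * b 0 0 - a 0 0 * b 0 2)
       (a 0 0 * b 0 1 - a 0 1 * b 0 0).

Definition Smx : 'M[R]_3 := diag_mx (row3 (-1) (-1) 1).

(* Indices start at 1, as for v; the value at j < 2 is junk.  Vectors are
   rows, and S is symmetric, so S(w) is w *m Smx. *)
Fixpoint wvec (v : nat -> 'rV[R]_3) (j : nat) : 'rV[R]_3 :=
  match j with
  | 0 | 1 => 0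
  | (j'.+1 as j1).+1 =>
      if j' is 0 then crossmul (v 1) (v 2)
      else crossmul (wvec v j1 *m Smx) (v j)
  end.

End CrossProducts.

Section QuotientRing.
Variables (F : fieldType) (k : nat).

(* v_(i,c), 1 <= i <= k, is the variable of index mxvec_index (i-1) c, where
   mxvec_index is the bijection 'I_k * 'I_3 -> 'I_(k * 3). *)
Definition vvec (i : nat) : 'rV[{mpoly F[k * 3]}]_3 :=
  if insub i.-1 is Some i' then \row_c 'X_(mxvec_index (i' : 'I_k) c) else 0.

Definition Ik : {pred {mpoly F[k * 3]}} :=
  ideal_gen [seq wvec vvec k 0 c | c <- enum 'I_3].

Lemma wvec_meval0 (x : 'I_(k * 3) -> F) j c :
  x =1 (fun=> 0) -> (wvec vvec j 0 c).@[x] = 0.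
Proof.
move=> x0.
have v0 i d : (vvec i 0 d).@[x] = 0.
  by rewrite /vvec; case: insub => [i'|]; rewrite mxE ?meval0 // mevalXU x0.
case: j => [|[|[|j]]] /=; rewrite ?mxE ?meval0 //.
  by case: c => -[|[|[|]]] //= _; rewrite mevalB !mevalM !v0 !mulr0 subrr.
by case: c => -[|[|[|]]] //= _; rewrite mevalB !mevalM !v0 !mulr0 subrr.
Qed.

Lemma Ik_closed : idealr_closed Ik.
Proof.
split.
- by apply/asboolP; exists (fun=> 0); rewrite big1 // => i _; rewrite mul0r.
- apply/asboolP => -[c e].
  have : (1 : {mpoly F[k * 3]}).@[fun=> 0] = 0.
    rewrite e raddf_sum big1 // => i _ /=; rewrite mevalM.
    have /mapP[d _ ->] := mem_nth 0 (ltn_ord i).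
    by rewrite wvec_meval0 // mulr0.
  by rewrite meval1 => /eqP; rewrite oner_eq0.
move=> a x y /asboolP[c ->] /asboolP[d ->]; apply/asboolP.
exists (fun i => a * c i + d i).
rewrite mulr_sumr -big_split; apply: eq_bigr => i _ /=.
by rewrite mulrDl mulrA.
Qed.

HB.instance Definition _ := isIdealr.Build {mpoly F[k * 3]} Ik Ik_closed.

Definition RmodI : comNzRingType := {ideal_quot Ik}.

End QuotientRing.

(* Main.v *)
From HB Require Import structures.
From mathcomp Require Import all_boot all_algebra.
From mathcomp Require Import generic_quotient ring_quotient.
From mathcomp Require Import boolp.
From mathcomp Require classical_sets.
From mathcomp Require Import mpoly.
From mathcomp Require Import ring zify.
Require Import Defs.

Set Implicit Arguments.
Unset Strict Implicit.
Unset Printing Implicit Defensive.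

Import GRing.Theory.

(** Let [u] be [S w_(k-1)], or [v_1] when [k = 2].  The generators of the ideal
    are the components of the cross product of [u] and [v_k], that is the 2 x 2
    minors of the matrix with rows [u] and [v_k].  Two facts about the quotient
    ring [A] give the result: for a suitable polynomial ring [B] in
    [d = 3 k - 2] variables inside the polynomial ring, [A] is finite over [B],
    and regular sequences of [B] remain regular on [A].

    Why this suffices ([CM_of_finite_flat]).  Let [P] be a maximal ideal of [A].
    By the Nullstellensatz ([maximal_algebraic]) each variable [y_i] of [B]
    satisfies a monic polynomial [f_i] modulo [P].  The [f_i (y_i)] form a
    regular sequence on [B], hence on [A] and on the localization at [P]; this
    gives depth at least [d].  Any [d + 1] elements of [A] are algebraically
    dependent over the field, by counting monomials ([algebraic_dependence]),
    whereas elements that separate the successive members of a chain of primes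
    are not ([chain_no_relation]); this gives dimension at most [d].  Finally, a
    regular sequence in a local ring always produces a chain of primes of the
    same length ([regular_seq_chain]), so that depth and dimension agree.

    Why regularity passes from [B] to [A] ([determinantal_flat]).  Modulo any
    ideal of [B] the ideal of minors still contains a regular sequence of length
    two, so by the Hilbert-Burch argument ([hilbert_burch]) the syzygies of the
    minors are generated by the two rows of the matrix.  A relation [f z = c . w]
    with [w] the vector of minors therefore can be divided by [f]: modulo [f] the
    vector [c] is a combination of rows, and these are orthogonal to [w].

    Why [A] is finite over [B].  Choose two of the variables, [X] and [Y], and
    write every other variable as a new parameter plus [X], [Y] or [0]; the
    parameters are the variables of [B].  The pattern rotates cyclically with
    the index of the vector, in such a way that the leading forms in [X] and [Y]
    of two components of [w_j] are [X^j] and [Y^j + X r], up to signs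
    ([lead_inv_cross]).  Hence the ideal contains elements with leading forms
    [X^k] and [Y^(k^2)] ([lead_inv_powers]), so finitely many monomials in [X]
    and [Y] span [A] over [B] ([finite_quotient]). *)

(** * Ideals and the basis theorem *)

Section Ideals.
Local Open Scope ring_scope.
Variable A : comNzRingType.
Implicit Types (J : A -> Prop) (s t : seq A) (x y z : A).

(** Unlike the type of proper ideals, this includes the unit ideal, which
    occurs among the ideals of leading coefficients and those generated by
    sequences. *)
Definition is_ideal J := J 0 /\ forall a x y, J x -> J y -> J (a * x + y).

Lemma is_idealD J x y : is_ideal J -> J x -> J y -> J (x + y).
Proof. by case=> _ h Jx Jy; rewrite -[x]mul1r; apply: h. Qed.

Lemma is_idealMl J a x : is_ideal J -> J x -> J (a * x).
Proof. by case=> J0 h Jx; rewrite -[_ * _]addr0; apply: h. Qed.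

Lemma is_idealN J x : is_ideal J -> J x -> J (- x).
Proof. by move=> idJ Jx; rewrite -mulN1r; apply: is_idealMl. Qed.

Lemma is_idealB J x y : is_ideal J -> J x -> J y -> J (x - y).
Proof. by move=> idJ Jx Jy; apply: is_idealD => //; apply: is_idealN. Qed.

Lemma is_ideal_sum J (I : Type) (r : seq I) (P : pred I) (f : I -> A) :
  is_ideal J -> (forall i, P i -> J (f i)) -> J (\sum_(i <- r | P i) f i).
Proof.
move=> idJ h; apply: (big_ind J) => //; first by case: idJ.
by move=> x y; apply: is_idealD.
Qed.

Lemma ideal_gen_ideal s : is_ideal (fun x => x \in ideal_gen s).
Proof.
split; first by apply/asboolP; exists (fun=> 0); rewrite big1 // => i _; ring.
move=> a x y /asboolP[c ->] /asboolP[d ->]; apply/asboolP.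
exists (fun i => a * c i + d i); rewrite mulr_sumr -big_split.
by apply: eq_bigr => i _ /=; ring.
Qed.

Lemma mem_ideal_gen s x : x \in s -> x \in ideal_gen s.
Proof.
move=> sx; apply/asboolP.
exists (fun i : 'I_(size s) => (i == index x s :> nat)%:R).
have lt : (index x s < size s)%N by rewrite index_mem.
rewrite (bigD1 (Ordinal lt)) //= eqxx mul1r nth_index // big1 ?addr0 //.
by move=> i ne; rewrite -val_eqE /= in ne; rewrite (negbTE ne) mul0r.
Qed.

Lemma ideal_gen_min J s x :
  is_ideal J -> (forall y, y \in s -> J y) -> x \in ideal_gen s -> J x.
Proof.
move=> idJ h /asboolP[c ->]; apply: is_ideal_sum => // i _.
by apply: is_idealMl => //; apply/h/mem_nth; exact: ltn_ord.
Qed.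

Lemma sub_ideal_gen s t : {subset s <= t} ->
  {subset ideal_gen s <= ideal_gen t}.
Proof.
move=> st x.
apply: (@ideal_gen_min (fun x => x \in ideal_gen t)); first exact: ideal_gen_ideal.
by move=> y /st yt; apply: mem_ideal_gen.
Qed.

Lemma ideal_gen_cat s t x y :
  x \in ideal_gen s -> y \in ideal_gen t -> x + y \in ideal_gen (s ++ t).
Proof.
move=> sx ty; apply: (is_idealD (J := fun x => x \in ideal_gen (s ++ t))).
- exact: ideal_gen_ideal.
- by apply: sub_ideal_gen sx => z; rewrite mem_cat => ->.
- by apply: sub_ideal_gen ty => z; rewrite mem_cat orbC => ->.
Qed.

Lemma ideal_gen_nil x : (x \in ideal_gen [::]) = (x == 0).
Proof.
apply/asboolP/eqP => [[c ->]|->]; first by rewrite big_ord0.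
by exists (fun=> 0); rewrite big_ord0.
Qed.

Lemma ideal_gen_rcons s y x :
  x \in ideal_gen (rcons s y) <-> exists c, x - c * y \in ideal_gen s.
Proof.
have idg := ideal_gen_ideal (rcons s y); have idgs := ideal_gen_ideal s.
split=> [|[c h]].
  apply: (ideal_gen_min (J := fun x => exists c, x - c * y \in ideal_gen s)).
    split; first by exists 0; rewrite mul0r subrr; case: idgs.
    move=> a u v [c hc] [d hd]; exists (a * c + d).
    have -> : a * u + v - (a * c + d) * y = a * (u - c * y) + (v - d * y) by ring.
    by case: idgs => _; apply.
  move=> z; rewrite mem_rcons inE => /orP[/eqP->|sz].
    by exists 1; rewrite mul1r subrr; case: idgs.
  by exists 0; rewrite mul0r subr0; apply: mem_ideal_gen.
rewrite -[x](subrK (c * y)); apply: (is_idealD idg).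
  by apply: sub_ideal_gen h => z; rewrite mem_rcons inE orbC => ->.
apply: (is_idealMl _ idg); apply: mem_ideal_gen.
by rewrite mem_rcons mem_head.
Qed.

Definition all_ideals_fg :=
  forall J, is_ideal J -> exists s, forall x, J x <-> x \in ideal_gen s.

Lemma idealr_is_ideal (I : idealr A) : is_ideal (fun x => x \in I).
Proof.
split; first exact: idealr0.
by move=> a x y Ix Iy; rewrite rpredD // idealMr.
Qed.

Lemma all_ideals_fg_noetherian : all_ideals_fg -> noetherian A.
Proof.
move=> h I; have [s hs] := h _ (idealr_is_ideal I).
by exists s => x; apply/idP/idP => /hs.
Qed.

End Ideals.

Section Noetherian.
Local Open Scope ring_scope.

Lemma field_all_ideals_fg (F : fieldType) : all_ideals_fg F.
Proof.
move=> J idJ; have [[x [Jx x0]]|h] := pselect (exists x, J x /\ x != 0).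
  exists [:: 1] => y; split=> _.
    rewrite -[y]mulr1; apply: (is_idealMl _ (ideal_gen_ideal _)).
    by apply: mem_ideal_gen; rewrite mem_head.
  by rewrite -[y](mulfVK x0); apply: is_idealMl.
exists [::] => x; rewrite ideal_gen_nil; split=> [Jx|/eqP->]; last by case: idJ.
by apply: contrapT => x0; apply: h; exists x; split => //; apply/negP.
Qed.

Lemma surj_all_ideals_fg (A B : comNzRingType) (f : {rmorphism A -> B}) :
  (forall y, exists x, f x = y) -> all_ideals_fg A -> all_ideals_fg B.
Proof.
move=> fS nA J idJ.
have [|s hs] := nA (fun x => J (f x)).
  split=> [|a x y Jx Jy]; first by rewrite rmorph0; case: idJ.
  by rewrite rmorphD rmorphM; case: idJ => _; apply.
exists (map f s) => y; split=> [Jy|].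
  have [x xy] := fS y; rewrite -xy in Jy *.
  apply: (ideal_gen_min (J := fun x => f x \in ideal_gen (map f s))) (_ : x \in ideal_gen s).
  - have [g0 g1] := ideal_gen_ideal (map f s).
    split=> [|a u v hu hv]; first by rewrite rmorph0.
    by rewrite rmorphD rmorphM; apply: g1.
  - by move=> z sz; apply/mem_ideal_gen/map_f.
  - exact/hs.
apply: ideal_gen_min => // _ /mapP[x sx ->].
by apply/hs/mem_ideal_gen.
Qed.

Lemma choose_preimages (T : Type) (U : eqType) (Q : T -> Prop) (f : T -> U) cs :
  (forall c, c \in cs -> exists p, Q p /\ f p = c) ->
  exists t : seq T, (forall i x0, (i < size t)%N -> Q (nth x0 t i)) /\ map f t = cs.
Proof.
elim: cs => [|c cs IH] h; first by exists [::].
have [|t [tQ <-]] := IH; first by move=> d dcs; apply: h; rewrite inE dcs orbT.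
have [p [Qp <-]] := h c (mem_head _ _).
by exists (p :: t); split=> // -[|i] x0 //= /tQ.
Qed.

Section HilbertBasis.
Variable A : comNzRingType.
Implicit Types (p q : {poly A}) (t : seq {poly A}).

Lemma cancel_top_coef t N n q : (forall p, p \in t -> (size p <= N.+1)%N) ->
  (N <= n)%N -> (size q <= n.+1)%N ->
  q`_n \in ideal_gen [seq p`_N | p : {poly A} <- t] ->
  exists2 r, r \in ideal_gen t & (size (q - r)%R <= n)%N.
Proof.
move=> st Nn sq /asboolP[]; rewrite size_map => c cE.
pose r := \sum_(i < size t) ((c i)%:P * 'X^(n - N) * t`_i).
exists r; first by apply/asboolP; exists (fun i => (c i)%:P * 'X^(n - N)).
have sr : (size r <= n.+1)%N.
  apply: leq_trans (size_sum _ _ _) _; apply/bigmax_leqP => i _.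
  rewrite -mulrA mul_polyC; apply: leq_trans (size_scale_leq _ _) _.
  apply: leq_trans (size_polyMleq _ _) _; rewrite size_polyXn /=.
  rewrite -{2}(subnK Nn) -addnS leq_add2l.
  by apply/st/mem_nth.
apply/leq_sizeP => j; rewrite leq_eqVlt => /orP[/eqP<-|ltj]; last first.
  rewrite coefB !nth_default ?subrr //; [exact: leq_trans sr _|exact: leq_trans sq _].
rewrite coefB cE coef_sum -sumrB big1 // => i _.
rewrite -mulrA coefCM coefXnM ltnNge leq_subr /= subKn //.
by rewrite (nth_map 0) ?subrr.
Qed.

Lemma shift_top_coef (J : {poly A} -> Prop) n k p : is_ideal J ->
  (n <= k)%N -> J p -> (size p <= n.+1)%N ->
  [/\ J ('X^(k - n) * p), (size ('X^(k - n) * p)%R <= k.+1)%N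
    & ('X^(k - n) * p)`_k = p`_n].
Proof.
move=> idJ nk Jp sp; split; first exact: is_idealMl.
  apply: leq_trans (size_polyMleq _ _) _; rewrite size_polyXn /=.
  by rewrite -{2}(subnK nk) -addnS leq_add2l.
by rewrite coefXnM ltnNge leq_subr /= subKn.
Qed.

(** Multiplying by powers of the variable makes degrees equal, so that
    coefficients can be added; [m] is the set of degrees considered, which is
    used for a single degree and for all degrees. *)
Lemma top_coefs_ideal (J : {poly A} -> Prop) (m : nat -> Prop) n0 :
  is_ideal J -> m n0 -> (forall n k, m n -> m k -> m (maxn n k)) ->
  is_ideal (fun c => exists n p, [/\ m n, J p, (size p <= n.+1)%N & p`_n = c]).
Proof.
move=> idJ mn0 mmax; split.
  by exists n0, 0; split; rewrite ?size_poly0 ?coef0 //; case: idJ.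
move=> a x y [n [p [mn Jp sp <-]]] [k [q [mk Jq sq <-]]].
have [Jp' sp' <-] := shift_top_coef idJ (leq_maxl n k) Jp sp.
have [Jq' sq' <-] := shift_top_coef idJ (leq_maxr n k) Jq sq.
move: ('X^_ * p) ('X^_ * q) Jp' sp' Jq' sq' => p' q' Jp' sp' Jq' sq'.
exists (maxn n k), (a%:P * p' + q'); split; first exact: mmax.
- by case: idJ => _; apply.
- apply: leq_trans (size_polyD _ _) _; rewrite geq_max sq' andbT.
  by rewrite mul_polyC; apply: leq_trans (size_scale_leq _ _) _.
- by rewrite coefD coefCM.
Qed.

(** Hilbert's basis theorem.  Finitely many members of [J] account for the
    top coefficients of all members of large degree; below that degree, the
    top coefficients are treated one degree at a time. *)
Lemma poly_all_ideals_fg : all_ideals_fg A -> all_ideals_fg {poly A}.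
Proof.
move=> nA J idJ.
have low n : exists t, (forall p, p \in t -> J p) /\
    forall q, J q -> (size q <= n)%N -> q \in ideal_gen t.
  elim: n => [|n [s [sJ IH]]].
    exists [::]; split=> // q _; rewrite leqn0 size_poly_eq0 => /eqP->.
    by rewrite ideal_gen_nil.
  have [|cs hcs] := nA (fun c =>
      exists k p, [/\ k = n, J p, (size p <= k.+1)%N & p`_k = c]).
    by apply: (@top_coefs_ideal J (eq^~ n) n) => // i j -> ->; rewrite maxnn.
  have [|t [tQ tE]] := @choose_preimages _ _
      (fun p => J p /\ (size p <= n.+1)%N) (fun p => p`_n) cs.
    by move=> c /mem_ideal_gen /hcs[k [p [-> Jp sp <-]]]; exists p.
  have {}tQ p : p \in t -> J p /\ (size p <= n.+1)%N.
    by move=> tp; rewrite -(nth_index 0 tp); apply: tQ; rewrite index_mem.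
  exists (s ++ t); split.
    by move=> p; rewrite mem_cat => /orP[/sJ|/tQ[]].
  move=> q Jq sq.
  have [|r tr sqr] := @cancel_top_coef t n n q (fun p tp => proj2 (tQ p tp)) (leqnn n) sq.
    by rewrite tE; apply/hcs; exists n, q.
  rewrite -[q](subrK r); apply: ideal_gen_cat => //; apply: IH => //.
  by apply: is_idealB => //; apply: ideal_gen_min tr => // p /tQ[].
have [|cs hcs] := nA (fun c =>
    exists k p, [/\ True, J p, (size p <= k.+1)%N & p`_k = c]).
  exact: (@top_coefs_ideal J (fun=> True) 0).
have [|t [tQ tE]] := @choose_preimages _ _
    (fun u : nat * {poly A} => J u.2 /\ (size u.2 <= u.1.+1)%N) (fun u => u.2`_u.1) cs.
  by move=> c /mem_ideal_gen /hcs[k [p [_ Jp sp <-]]]; exists (k, p).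
have {}tQ u : u \in t -> J u.2 /\ (size u.2 <= u.1.+1)%N.
  by move=> tp; rewrite -(nth_index (0, 0) tp); apply: tQ; rewrite index_mem.
pose N := \max_(u <- t) u.1.
have Nt u : u \in t -> (u.1 <= N)%N by move=> ut; apply: leq_bigmax_seq.
pose t' := [seq 'X^(N - u.1) * u.2 | u <- t].
have t'Q p : p \in t' -> J p /\ (size p <= N.+1)%N.
  move=> /mapP[u tu ->]; have [Ju su] := tQ u tu.
  by have [] := shift_top_coef idJ (Nt u tu) Ju su.
have t'E : [seq p`_N | p : {poly A} <- t'] = cs.
  rewrite -tE -map_comp; apply/eq_in_map => u tu /=; have [Ju su] := tQ u tu.
  by have [] := shift_top_coef idJ (Nt u tu) Ju su.
have [s [sJ hs]] := low N.
exists (s ++ t') => q; split; last first.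
  by apply: ideal_gen_min => // p; rewrite mem_cat => /orP[/sJ|/t'Q[]].
have [n] := ubnP (size q); elim: n q => // n IH q; rewrite ltnS => sqn Jq.
have [leN|ltN] := leqP (size q) N.
  apply: sub_ideal_gen (hs q Jq leN) => p sp; by rewrite mem_cat sp.
case: n => [|n] in IH sqn *; first by move: (leq_trans ltN sqn).
have [|r tr sqr] := @cancel_top_coef t' N n q (fun p tp => proj2 (t'Q p tp))
    (leq_trans ltN sqn) sqn.
  rewrite t'E; apply/hcs; exists n, q; by split.
rewrite -[q](subrK r); apply: (is_idealD (ideal_gen_ideal _)).
  apply: IH => //; apply: is_idealB => //; apply: ideal_gen_min tr => // p.
  by case/t'Q.
by apply: sub_ideal_gen tr => p tp; rewrite mem_cat tp orbT.
Qed.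

End HilbertBasis.
End Noetherian.

(** * Prime ideals and chains from regular sequences *)

Section Primes.
Local Open Scope ring_scope.
Variable A : comNzRingType.
Implicit Types (J M : A -> Prop) (s : seq A) (x y z : A).

Lemma mk_idealr J : is_ideal J -> ~ J 1 ->
  exists I : idealr A, forall x, (x \in I) <-> J x.
Proof.
move=> [J0 Jl] J1; pose S : {pred A} := fun x => `[< J x >].
have cS : idealr_closed S.
  split; first exact/asboolP.
    by apply/asboolP.
  by move=> a x y /asboolP Jx /asboolP Jy; apply/asboolP/Jl.
pose I : idealr A := HB.pack (S : A -> bool) (isIdealr.Build A S cS).
by exists I => x; split=> /asboolP.
Qed.

Lemma mk_prime_idealr J : is_ideal J -> ~ J 1 ->
    (forall x y, J (x * y) -> J x \/ J y) ->
  exists P : prime_idealr A, forall x, (x \in P) <-> J x.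
Proof.
move=> [J0 Jl] J1 Jp; pose S : {pred A} := fun x => `[< J x >].
have cS : idealr_closed S.
  split; first exact/asboolP.
    by apply/asboolP.
  by move=> a x y /asboolP Jx /asboolP Jy; apply/asboolP/Jl.
have pS : prime_idealr_closed S.
  by move=> x y /asboolP/Jp[] h; apply/orP; [left|right]; apply/asboolP.
pose P : prime_idealr A := HB.pack (S : A -> bool) (isIdealr.Build A S cS)
  (isPrimeIdealrClosed.Build A S pS).
by exists P => x; split=> /asboolP.
Qed.

(** An ideal maximal among those that contain [J] and avoid a multiplicative
    set is prime. *)
Lemma prime_avoiding J M : is_ideal J -> M 1 ->
    (forall x y, M x -> M y -> M (x * y)) -> (forall x, J x -> ~ M x) ->
  exists P : prime_idealr A, (forall x, J x -> x \in P) /\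
    (forall x, x \in P -> ~ M x).
Proof.
move=> idJ M1 MM JM.
pose good (X : A -> Prop) :=
  [/\ is_ideal X, forall x, J x -> X x & forall x, X x -> ~ M x].
pose cand (X : A -> Prop) := (forall x, ~ X x) \/ good X.
(* The empty set is a candidate because it is the union of the empty chain. *)
have [F Fc Ftot|Q [cQ Qmax]] := @classical_sets.Zorn_bigcup A cand.
  have [[X0 [FX0 [x0 X0x0]]]|h] := pselect (exists X, F X /\ exists x, X x);
    last by left=> x [X FX Xx]; apply: h; exists X; split=> //; exists x.
  have Fgood X x : F X -> X x -> good X.
    by move=> FX Xx; case: (Fc X FX) => // /(_ x).
  right; split.
  - split; first by exists X0 => //; have [[]] := Fgood _ _ FX0 X0x0.
    move=> a x y [X FX Xx] [Y FY Yy].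
    have [XY|YX] := Ftot X Y FX FY.
      exists Y => //; have [[_ Yl] _ _] := Fgood _ _ FY Yy.
      by apply: Yl => //; apply: XY.
    exists X => //; have [[_ Xl] _ _] := Fgood _ _ FX Xx.
    by apply: Xl => //; apply: YX.
  - by move=> x Jx; exists X0 => //; have [_ h _] := Fgood _ _ FX0 X0x0; apply: h.
  - by move=> x [X FX Xx]; have [_ _ h] := Fgood _ _ FX Xx; apply: h.
have {cQ} [idQ JQ QM] : good Q.
  case: cQ => // Q0; exfalso; apply: (Qmax J).
    by split=> [x /Q0//|h]; apply: (Q0 0); apply: h; case: idJ.
  by right; split.
have enlarge u : ~ Q u -> exists q a, Q q /\ M (q + a * u).
  move=> Qu; apply: contrapT => h.
  apply: (Qmax (fun x => exists q a, Q q /\ x = q + a * u)).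
    split=> [x Qx|sub]; first by exists x, 0; split; rewrite ?mul0r ?addr0.
    apply: Qu; apply: sub; exists 0, 1; split; first by case: idQ.
    by rewrite mul1r add0r.
  right; split.
  - split; first by exists 0, 0; split; [case: idQ|rewrite mul0r addr0].
    move=> c x y [q [a [Qq ->]]] [r [b [Qr ->]]].
    exists (c * q + r), (c * a + b); split; last by ring.
    by case: idQ => _; apply.
  - by move=> x Jx; exists x, 0; split; [apply: JQ|rewrite mul0r addr0].
  - by move=> x [q [a [Qq ->]]] Mx; apply: h; exists q, a.
have Q1 : ~ Q 1 by move=> /QM.
have [|P hP] := mk_prime_idealr idQ Q1.
  move=> u v Quv; apply: contrapT => /not_orP[Qu Qv].
  have [q [a [Qq Mq]]] := enlarge u Qu; have [r [b [Qr Mr]]] := enlarge v Qv.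
  apply: QM (MM _ _ Mq Mr).
  have -> : (q + a * u) * (r + b * v) =
    (r + b * v) * q + (a * u * r + (a * b) * (u * v)) by ring.
  case: (idQ) => _; apply => //; apply: is_idealD => //; exact: is_idealMl.
exists P; split=> x; first by move/JQ/hP.
by move/hP/QM.
Qed.

(** The key to the comparison of depth and dimension: a nonzerodivisor modulo
    [J] lies outside some smaller prime containing [J], namely one avoiding the
    products of powers of [s] and elements outside [Q]. *)
Lemma smaller_prime J (Q : prime_idealr A) (s : A) : is_ideal J ->
    (forall x, J x -> x \in Q) -> (forall x, J (s * x) -> J x) ->
  exists P : prime_idealr A,
    [/\ forall x, J x -> x \in P, {subset P <= Q} & s \notin P].
Proof.
move=> idJ JQ sJ.
have sXJ n x : J (s ^+ n * x) -> J x.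
  by elim: n => [|n IH]; rewrite ?mul1r // exprS -mulrA => /sJ.
have [||x Jx [n [y [Qy xE]]]|P [JP PM]] := @prime_avoiding J
    (fun x => exists n y, y \notin Q /\ x = s ^+ n * y) idJ.
- by exists 0, 1; rewrite idealr1 mulr1.
- move=> x y [n [u [Qu ->]]] [m [v [Qv ->]]]; exists (n + m)%N, (u * v).
  by rewrite prime_idealrM negb_or Qu Qv; split=> //; rewrite exprD; ring.
- by move: Jx; rewrite xE => /sXJ/JQ Qy'; rewrite Qy' in Qy.
exists P; split=> // [x Px|].
  apply: contrapT => /negP Qx; apply: (PM _ Px).
  by exists 0, x; rewrite mul1r.
apply/negP => Ps; apply: (PM _ Ps); exists 1, 1.
by rewrite idealr1 expr1 mulr1.
Qed.

(** Descending from [Q], each element of the sequence, the last one first, is a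
    nonzerodivisor modulo its predecessors and therefore leaves some smaller
    prime that contains these predecessors. *)
Lemma regular_seq_chain s (Q : prime_idealr A) :
    {subset s <= Q} -> regular_seq s ->
  exists p : 'I_(size s).+1 -> prime_idealr A,
    prime_chain p /\ p ord_max = Q.
Proof.
move=> sQ [_]; elim/last_ind: s Q sQ => [|s y IH] Q sQ reg.
  exists (fun=> Q); split=> // i j; rewrite !ord1 //.
have [||x|P [sP PQ yP]] := @smaller_prime (fun x => x \in ideal_gen s) Q y.
- exact: ideal_gen_ideal.
- move=> x; apply: (@ideal_gen_min _ (fun x => x \in Q)); first exact: idealr_is_ideal.
  by move=> z sz; apply: sQ; rewrite mem_rcons inE sz orbT.
- have := reg (size s); rewrite size_rcons ltnSn => /(_ isT x).
  by rewrite nth_rcons ltnn eqxx -cats1 take_size_cat.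
have [||p [pc pP]] := IH P.
- by move=> x sx; apply/sP/mem_ideal_gen.
- move=> i lti x; have := reg i; rewrite size_rcons ltnS ltnW // => /(_ isT x).
  by rewrite nth_rcons lti -cats1 takel_cat // ltnW.
rewrite size_rcons.
pose q (i : 'I_(size s).+2) : prime_idealr A :=
  if unlift ord_max i is Some j then p j else Q.
have qlift j : q (lift ord_max j) = p j by rewrite /q liftK.
have qmax : q ord_max = Q by rewrite /q unlift_none.
exists q; split=> // i j.
have pP' k : {subset p k <= P}.
  have [->|ne] := eqVneq k ord_max; first by rewrite pP.
  have /pc[h _] : (k < @ord_max (size s))%N.
    by rewrite ltn_neqAle ne -ltnS ltn_ord.
  by rewrite -pP.
have [k ->|->] := unliftP ord_max i; have [l ->|->] := unliftP ord_max j.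
- by rewrite !qlift !lift_max; apply: pc.
- rewrite qlift qmax lift_max => _; split; first by move=> x /pP'/PQ.
  move=> QP; move/negP: yP; apply; apply/pP'/QP/sQ.
  by rewrite mem_rcons mem_head.
- by rewrite lift_max /= ltnNge (ltnW (ltn_ord l)).
- by rewrite ltnn.
Qed.

End Primes.

(** * Localization *)

Section LocalizationMap.
Local Open Scope ring_scope.
Local Open Scope quotient_scope.
Variables (A : comNzRingType) (P : prime_idealr A).
Local Notation T := (Localization.type P).
Local Notation den1 := (Localization.den1 P).

Definition loc_fun (a : A) : localization P := \pi_T (a, den1).

Lemma loc_fun_is_additive : {morph loc_fun : x y / x - y}.
Proof.
move=> x y; rewrite /loc_fun.
have -> : \pi_T (x, den1) - \pi_T (y, den1) =
    Localization.add (\pi_T (x, den1)) (Localization.opp (\pi_T (y, den1))) by [].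
rewrite -Localization.pi_opp -Localization.pi_add.
apply/eqmodP/asboolP; exists den1 => /=; ring.
Qed.

Lemma loc_fun_is_multiplicative : loc_fun 1 = 1 /\ {morph loc_fun : x y / x * y}.
Proof.
split=> [|x y]; rewrite /loc_fun.
  have -> : (1 : localization P) = Localization.one P by [].
  by rewrite piE.
have -> : \pi_T (x, den1) * \pi_T (y, den1) =
    Localization.mul (\pi_T (x, den1)) (\pi_T (y, den1)) by [].
rewrite -Localization.pi_mul.
by apply/eqmodP/asboolP; exists den1 => /=; ring.
Qed.

HB.instance Definition _ := GRing.isZmodMorphism.Build A (localization P) loc_fun
  loc_fun_is_additive.
HB.instance Definition _ := GRing.isMonoidMorphism.Build A (localization P) loc_fun
  loc_fun_is_multiplicative.

Definition loc : {rmorphism A -> localization P} := loc_fun.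

Lemma loc_frac (z : localization P) :
  exists a s, s \notin P /\ z * loc s = loc a.
Proof.
elim/quotW: z => -[a s]; exists a, (sval s); split; first exact: (svalP s).
have -> : \pi_T (a, s) * loc (sval s) =
    Localization.mul (\pi_T (a, s)) (\pi_T (sval s, den1)) by [].
rewrite -Localization.pi_mul.
by apply/eqmodP/asboolP; exists den1 => /=; ring.
Qed.

Lemma loc_unit s : s \notin P -> exists t, loc s * t = 1.
Proof.
move=> Ps; exists (\pi_T (1, (exist _ s Ps : Localization.den P))).
rewrite -(rmorph1 loc).
have -> : loc s * \pi_T (1, (exist _ s Ps : Localization.den P)) =
    Localization.mul (\pi_T (s, den1)) (\pi_T (1, (exist _ s Ps : Localization.den P))) by [].
rewrite -Localization.pi_mul.
by apply/eqmodP/asboolP; exists den1 => /=; ring.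
Qed.

Lemma loc_eq0 a : loc a = 0 -> exists2 u, u \notin P & u * a = 0.
Proof.
move=> h; have /eqmodP/asboolP[u /= e] : loc a = \pi_T (0, den1).
  by rewrite h -(rmorph0 loc).
exists (sval u); first exact: (svalP u).
by move: e; rewrite !mulr1 mulr0.
Qed.

End LocalizationMap.

Section LocalCM.
Local Open Scope ring_scope.
Variables (A : comNzRingType) (P : prime_idealr A).
Local Notation L := (localization P).
Local Notation loc := (loc P).

Lemma loc_gen s a : loc a \in ideal_gen (map loc s) ->
  exists2 u, u \notin P & u * a \in ideal_gen s.
Proof.
pose J z := exists b u, [/\ u \notin P, b \in ideal_gen s & loc u * z = loc b].
have [g0 gl] := ideal_gen_ideal s.
have idJ : is_ideal J.
  split; first by exists 0, 1; rewrite idealr1 rmorph0 mulr0.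
  move=> c x y [b [u [Pu gb ub]]] [d [v [Pv gd vd]]].
  have [e [w [Pw we]]] := loc_frac c.
  exists (v * e * b + u * w * d), (w * u * v); split.
  - by rewrite !prime_idealrM !negb_or Pu Pv Pw.
  - by apply: gl => //; apply: (@is_idealMl _ (fun x => x \in ideal_gen s)) => //; exact: ideal_gen_ideal.
  - rewrite rmorphD !rmorphM -ub -vd -we; ring.
move=> ga; have [b [u [Pu gb ub]]] : J (loc a).
- apply: ideal_gen_min idJ _ ga => _ /mapP[x sx ->].
  by exists x, 1; rewrite idealr1 rmorph1 mul1r; split=> //; apply: mem_ideal_gen.
have [|w Pw wab] := @loc_eq0 _ P (u * a - b).
  by rewrite rmorphB rmorphM ub subrr.
exists (w * u); first by rewrite prime_idealrM negb_or Pw.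
have -> : w * u * a = w * b by apply/eqP; rewrite -subr_eq0 -mulrA -mulrBr wab.
exact: (is_idealMl _ (ideal_gen_ideal s)).
Qed.

Lemma gen_loc s a : a \in ideal_gen s -> loc a \in ideal_gen (map loc s).
Proof.
have [g0 gl] := ideal_gen_ideal (map loc s).
apply: (@ideal_gen_min _ (fun a => loc a \in ideal_gen (map loc s))).
  split=> [|c x y hx hy]; first by rewrite rmorph0.
  by rewrite rmorphD rmorphM; apply: gl.
by move=> y sy; apply/mem_ideal_gen/map_f.
Qed.

(** The fractions with numerator in [P]; all others are invertible, which makes
    this ideal the only maximal one. *)
Lemma local_maximal_ideal : exists m : idealr L,
  [/\ forall z, z \notin m -> exists t, z * t = 1 & forall a, a \in P -> loc a \in m].
Proof.
pose J z := exists a s, [/\ a \in P, s \notin P & z * loc s = loc a].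
have idJ : is_ideal J.
  split; first by exists 0, 1; rewrite idealr0 idealr1 rmorph0 mul0r.
  move=> c x y [a [s [Pa Ps e]]] [b [t [Pb Pt f]]].
  have [d [w [Pw we]]] := loc_frac c.
  exists (d * t * a + w * s * b), (w * s * t); split.
  - by rewrite rpredD // idealMr.
  - by rewrite !prime_idealrM !negb_or Ps Pt Pw.
  - rewrite rmorphD !rmorphM -e -f -we; ring.
have J1 : ~ J 1.
  move=> [a [s [Pa Ps]]]; rewrite mul1r => /eqP; rewrite -subr_eq0 -rmorphB.
  move=> /eqP/loc_eq0[u Pu /eqP]; rewrite mulrBr subr_eq0 => /eqP e.
  have : u * s \in P by rewrite e idealMr.
  by rewrite prime_idealrM (negbTE Pu) (negbTE Ps).
have [m hm] := mk_idealr idJ J1; exists m; split=> [z mz|a Pa]; last first.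
  by apply/hm; exists a, 1; rewrite idealr1 rmorph1 mulr1.
have [a [s [Ps e]]] := loc_frac z.
have [Pa|Pa] := boolP (a \in P).
  by move/negP: mz; case; apply/hm; exists a, s.
have [t ta] := loc_unit Pa; exists (loc s * t).
by rewrite mulrA e.
Qed.

(** Localization preserves regular sequences, and every regular sequence of the
    local ring yields a chain of primes.  Hence the bound [d] on chains bounds
    the depth, and a single regular sequence of length [d] shows that both the
    depth and the dimension are [d]. *)
Lemma CM_local_loc d s :
    (forall n (p : 'I_n.+1 -> prime_idealr L), prime_chain p -> (n <= d)%N) ->
    {subset s <= P} -> size s = d ->
    (forall i, (i < size s)%N -> forall x,
      s`_i * x \in ideal_gen (take i s) -> x \in ideal_gen (take i s)) ->
  CM_local L.
Proof.
move=> dimL sP ss reg; have [m [mU Pm]] := local_maximal_ideal.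
have maxm (J : idealr L) : (1 : L) \notin J -> {subset J <= m}.
  move=> J1 z Jz; apply: contraT => /mU[t zt].
  by move: J1; rewrite -zt mulrC idealMr.
have mprime (x y : L) : x * y \in m -> x \in m \/ y \in m.
  move=> mxy; have [mx|/mU[t xt]] := boolP (x \in m); [by left|right].
  by rewrite -[y]mul1r -xt mulrAC mulrC idealMr.
have [Q hQ] : exists Q : prime_idealr L, forall x, x \in Q <-> x \in m.
  apply: (@mk_prime_idealr _ (fun x => x \in m)) => //.
    exact: idealr_is_ideal.
  by rewrite idealr1.
have regm (t : seq L) : {subset t <= m} -> regular_seq t -> exists p : 'I_(size t).+1 -> prime_idealr L, prime_chain p.
  move=> tm rt; have [|p [pc _]] := @regular_seq_chain _ t Q _ rt; last by exists p.
  by move=> x /tm /hQ.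
have rs : regular_seq (map loc s).
  split.
    apply/negP => /(@ideal_gen_min _ (fun x => x \in m)) h.
    have: (1 : L) \in m.
      apply: h; first exact: idealr_is_ideal.
      by move=> _ /mapP[x /sP/Pm mx ->].
    by rewrite idealr1.
  rewrite size_map => i lti z; rewrite (nth_map 0) // -map_take => h.
  have [a [t [Pt e]]] := loc_frac z.
  have [|u Pu] := @loc_gen (take i s) (s`_i * a).
    rewrite rmorphM -e mulrA mulrC.
    exact: (is_idealMl _ (ideal_gen_ideal _)).
  rewrite mulrCA => /(reg i lti)/gen_loc.
  have [t' tt'] := loc_unit Pt; have [u' uu'] := loc_unit Pu.
  move=> /(is_idealMl (t' * u') (ideal_gen_ideal _)); rewrite rmorphM -e.
  have -> : t' * u' * (loc u * (z * loc t)) = (loc u * u') * (loc t * t') * z by ring.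
  by rewrite uu' tt' !mul1r.
have ms : {subset map loc s <= m} by move=> _ /mapP[x /sP/Pm mx ->].
exists m, d; split.
- by move=> J _; apply: maxm; rewrite idealr1.
- move=> J Jmax x; apply/idP/idP; last first.
    by apply: Jmax; apply: maxm; rewrite idealr1.
  by apply: maxm; rewrite idealr1.
- split; last exact: dimL.
  by have [p pc] := regm _ ms rs; rewrite size_map ss in p pc; exists p.
- split; first by exists (map loc s); rewrite size_map.
  by move=> t tm /(regm _ tm)[p /dimL].
Qed.

End LocalCM.

(** * Iterated polynomial rings *)

Section Tower.
Local Open Scope ring_scope.

(** Polynomial rings in [n] variables, one variable at a time, since the proofs
    below are inductions on the number of variables; the outermost variable has
    index [n - 1]. *)
Fixpoint tower (D : comNzRingType) (n : nat) : comNzRingType :=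
  if n is m.+1 then {poly tower D m} else D.

Fixpoint tX (D : comNzRingType) (n i : nat) : tower D n :=
  match n with
  | 0 => 0
  | m.+1 => if i == m then 'X else (tX D m i)%:P
  end.

Fixpoint tC (D : comNzRingType) (n : nat) : {rmorphism D -> tower D n} :=
  match n with
  | 0 => idfun
  | m.+1 => polyC \o tC D m
  end.

Section Eval.
Variables (D C : comNzRingType) (phi : {rmorphism D -> C}) (a : nat -> C).

Lemma commr_rmorph_all (T : comNzRingType) (f : {rmorphism T -> C}) u :
  commr_rmorph f u.
Proof. by move=> x; apply: mulrC. Qed.

Fixpoint teval (n : nat) : {rmorphism tower D n -> C} :=
  match n with
  | 0 => phi
  | m.+1 => horner_morph (commr_rmorph_all (teval m) (a m))
  end.

Lemma tevalX n i : (i < n)%N -> teval n (tX D n i) = a i.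
Proof.
elim: n => //= n IH; rewrite ltnS leq_eqVlt => /orP[/eqP->|lti].
  by rewrite eqxx horner_morphX.
by rewrite (ltn_eqF lti) horner_morphC IH.
Qed.

Lemma tevalC n c : teval n (tC D n c) = phi c.
Proof. by elim: n => //= n IH; rewrite horner_morphC. Qed.

End Eval.

Lemma tower_all_ideals_fg (F : fieldType) n : all_ideals_fg (tower F n).
Proof.
elim: n => [|n IH]; first exact: field_all_ideals_fg.
exact: poly_all_ideals_fg.
Qed.

(** Two ring homomorphisms on a polynomial ring that agree on constants and
    variables are equal. *)
Lemma tower_ext (D C : comNzRingType) n (f g : {rmorphism tower D n -> C}) :
  (forall c, f (tC D n c) = g (tC D n c)) ->
  (forall i, (i < n)%N -> f (tX D n i) = g (tX D n i)) -> f =1 g.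
Proof.
elim: n f g => [|n IH] f g fgC fgX p; first exact: fgC.
have fgP : f \o polyC =1 g \o polyC.
  apply: IH => [c|i lti] /=; first exact: (fgC c).
  by have := fgX i (ltnW lti); rewrite /= (ltn_eqF lti).
rewrite /= in p *.
have fgXn : f 'X = g 'X by have := fgX n (ltnSn n); rewrite /= eqxx.
rewrite -[p]coefK poly_def !rmorph_sum; apply: eq_bigr => i _.
by rewrite -mul_polyC !rmorphM !rmorphXn fgXn; congr (_ * _); apply: fgP.
Qed.

End Tower.
(** * Dimension: algebraic dependence bounds chains of primes *)

Section ChainRelation.
Local Open Scope ring_scope.
Variables (F : fieldType) (L : comNzRingType) (phi : {rmorphism F -> L}).

(** A nonzero polynomial relation among elements separating the members of a
    chain of primes is impossible: modulo the larger prime the polynomial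
    reduces to its constant term, while powers of the variable can be
    cancelled modulo the smaller one. *)
Lemma chain_no_relation n (q : nat -> prime_idealr L) (a : nat -> L) :
    (forall i, (i < n)%N ->
      [/\ a i \in q i, a i \notin q i.+1 & {subset q i.+1 <= q i}]) ->
  forall p : tower F n, teval phi a n p \in q n -> p = 0.
Proof.
elim: n => [|n IH] hq p.
  rewrite /= => qp; apply: contraTeq qp => p0; apply/negP => qp.
  have := idealMr (phi p^-1) qp.
  by rewrite -rmorphM mulVf // rmorph1 idealr1.
have [qa qa' qq] := hq n (ltnSn n).
rewrite /= in p *; elim/poly_ind: p => [//|p c IHp].
rewrite rmorphD rmorphM /= horner_morphX horner_morphC => h.
have c0 : c = 0.
  apply: IH => [i lti|]; first exact: (hq i (ltnW lti)).
  move: h; set u := _ * a n => h.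
  have -> : teval phi a n c = u + teval phi a n c - u by ring.
  by rewrite rpredB // ?(qq _ h) // /u idealMr.
move: h; rewrite c0 rmorph0 !addr0 prime_idealrM (negbTE qa') orbF.
by move/IHp ->; rewrite mul0r.
Qed.

End ChainRelation.

Section Counting.
Local Open Scope ring_scope.

(** [M] bounds the degree in each variable separately, strictly: there are
    [M ^ n] monomials within the bound. *)
Fixpoint tdeg (D : comNzRingType) (M n : nat) : tower D n -> Prop :=
  match n with
  | 0 => fun=> True
  | m.+1 => fun p : {poly tower D m} =>
      (size p <= M)%N /\ forall i, tdeg M p`_i
  end.
Arguments tdeg {D} M {n}.

Section Degree.
Variable D : comNzRingType.

Lemma tdeg0 M n : tdeg M (0 : tower D n).
Proof.
elim: n => //= n IH; split; first by rewrite size_poly0.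
by move=> i; rewrite coef0.
Qed.

Lemma tdegD M n (p q : tower D n) : tdeg M p -> tdeg M q -> tdeg M (p + q).
Proof.
elim: n p q => //= n IH p q [sp hp] [sq hq]; split.
  by apply: leq_trans (size_polyD _ _) _; rewrite geq_max sp.
by move=> i; rewrite coefD; apply: IH.
Qed.

Lemma tdeg_sum M n (I : finType) (f : I -> tower D n) :
  (forall i, tdeg M (f i)) -> tdeg M (\sum_i f i).
Proof.
move=> h; apply: (big_ind (fun p : tower D n => tdeg M p)) => //.
  exact: tdeg0.
exact: tdegD.
Qed.

Lemma tdegM M N n (p q : tower D n) :
  tdeg M p -> tdeg N q -> tdeg (M + N) (p * q).
Proof.
elim: n p q => //= n IH p q [sp hp] [sq hq]; split.
  apply: leq_trans (size_polyMleq _ _) _; apply: leq_trans (leq_pred _) _.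
  exact: leq_add.
move=> i; rewrite coefM; apply: tdeg_sum => j; exact: IH.
Qed.

Lemma tdeg_le M N n (p : tower D n) : (M <= N)%N -> tdeg M p -> tdeg N p.
Proof.
move=> MN; elim: n p => //= n IH p [sp hp]; split; first exact: leq_trans MN.
by move=> i; apply: IH.
Qed.

Lemma uniform_bound (I : finType) (Q : I -> nat -> Prop) :
  (forall i, exists M, Q i M) -> (forall i M N, (M <= N)%N -> Q i M -> Q i N) ->
  exists M, forall i, Q i M.
Proof.
move=> /boolp.choice[f hf] mono; exists (\max_i f i) => i.
by apply: mono (hf i); apply: leq_bigmax.
Qed.

Lemma tdeg_ex n (p : tower D n) : exists M, tdeg M p.
Proof.
elim: n p => [|n IH] p; first by exists 0.
have [||M hM] := @uniform_bound 'I_(size p) (fun i M => tdeg M p`_i).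
- by move=> i; apply: IH.
- by move=> i M N; apply: tdeg_le.
exists (maxn (size p) M) => /=; split; first exact: leq_maxl.
move=> i; have [lti|gei] := ltnP i (size p).
  by apply: tdeg_le (hM (Ordinal lti)); apply: leq_maxr.
by rewrite nth_default //; apply: tdeg0.
Qed.

End Degree.

Fixpoint idx (N n : nat) : finType :=
  if n is m.+1 then ('I_N * idx N m)%type else unit.

Lemma card_idx N n : #|idx N n| = (N ^ n)%N.
Proof. by elim: n => [|n IH] /=; rewrite ?card_unit // card_prod card_ord IH expnS. Qed.

Section Monomials.
Variables (F : fieldType) (C : comNzRingType) (phi : {rmorphism F -> C}).

Fixpoint mono (a : nat -> C) (N n : nat) : idx N n -> C :=
  match n with
  | 0 => fun=> 1
  | m.+1 => fun u => a m ^+ u.1 * mono a u.2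
  end.

(** The polynomial with given coefficients on the monomials of [idx N n]. *)
Fixpoint build (N n : nat) : (idx N n -> F) -> tower F n :=
  match n with
  | 0 => fun l => l tt
  | m.+1 => fun l => \sum_(i < N) (build (fun u => l (i, u)))%:P * 'X^i
  end.

Lemma coef_build N n (l : idx N n.+1 -> F) (i : 'I_N) :
  (build l : {poly tower F n})`_i = build (fun u => l (i, u)).
Proof.
rewrite /= coef_sum (bigD1 i) //= coefCM coefXn eqxx mulr1 big1 ?addr0 //.
move=> j ji; rewrite coefCM coefXn eq_sym val_eqE (negbTE ji) mulr0 //.
Qed.

Lemma build_eq0 N n (l : idx N n -> F) : build l = 0 -> forall u, l u = 0.
Proof.
elim: n l => [|n IH] l h u; first by case: u.
case: u => i u; apply: (IH (fun u => l (i, u))).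
by rewrite -coef_build h coef0.
Qed.

Lemma build_surj M n (p : tower F n) : tdeg M p -> exists l : idx M n -> F, p = build l.
Proof.
elim: n p => [|n IH] p; first by exists (fun=> p).
move=> [sp hp].
have /boolp.choice[l hl] : forall i : 'I_M, exists l : idx M n -> F, p`_i = build l.
  by move=> i; apply/IH/hp.
exists (fun u => l u.1 u.2); apply/polyP => i.
have [lti|gei] := ltnP i M; first by rewrite (coef_build _ (Ordinal lti)) /= -hl.
rewrite nth_default; last exact: leq_trans gei.
rewrite /= coef_sum big1 // => j _; rewrite coefCM coefXn.
by rewrite gtn_eqF ?mulr0 // (leq_trans _ gei).
Qed.

Lemma teval_build a N n (l : idx N n -> F) :
  teval phi a n (build l) = \sum_u phi (l u) * mono a u.
Proof.
elim: n l => [|n IH] l /=; first by rewrite (bigD1 tt) //= big1 ?addr0 ?mulr1 // => -[].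
rewrite rmorph_sum /=.
transitivity (\sum_(i < N) \sum_(u : idx N n) phi (l (i, u)) * (a n ^+ i * mono a u)).
  apply: eq_bigr => i _; rewrite rmorphM rmorphXn /= horner_morphX horner_morphC IH.
  by rewrite mulr_suml; apply: eq_bigr => u _; ring.
by rewrite pair_bigA /=; apply: eq_bigr => -[].
Qed.

(** The coordinate vectors with respect to the [g j] are more numerous than
    their entries, so the matrix they form has a nonzero left kernel. *)
Lemma linear_dependence (I J : finType) (x : I -> C) (g : J -> C) :
  (forall i, exists c : J -> F, x i = \sum_j phi (c j) * g j) ->
  (#|J| < #|I|)%N ->
  exists l : I -> F, (exists i, l i != 0) /\ \sum_i phi (l i) * x i = 0.
Proof.
move=> /boolp.choice[c hc] lt.
pose m := \matrix_(i < #|I|, j < #|J|) c (enum_val i) (enum_val j).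
have kn0 : kermx m != 0.
  rewrite -mxrank_eq0 mxrank_ker -lt0n subn_gt0.
  exact: leq_ltn_trans (rank_leq_col m) lt.
have [i hi] : exists i, row i (kermx m) != 0.
  apply/existsP; rewrite -negb_forall; apply: contra kn0 => /forallP h.
  by apply/eqP/row_matrixP => i; rewrite row0; apply/eqP/h.
have /existsP[k hk] : [exists k, kermx m i k != 0].
  rewrite -negb_forall; apply: contra hi => /forallP h.
  by apply/eqP/rowP => k; rewrite [RHS]mxE [LHS]mxE; apply/eqP/h.
exists (fun u => kermx m i (enum_rank u)); split.
  by exists (enum_val k); rewrite enum_valK.
have kj j : \sum_u kermx m i (enum_rank u) * c u j = 0.
  have /matrixP/(_ i (enum_rank j)) := mulmx_ker m; rewrite !mxE => e.
  rewrite -[RHS]e [LHS](reindex (fun k : 'I_#|I| => enum_val k)) /=; last first.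
    by exists enum_rank => u _; [apply: enum_valK|apply: enum_rankK].
  by apply: eq_bigr => u _; rewrite enum_valK [m u _]mxE enum_rankK.
transitivity (\sum_j \sum_u phi (kermx m i (enum_rank u) * c u j) * g j).
  rewrite exchange_big; apply: eq_bigr => u _; rewrite hc mulr_sumr.
  by apply: eq_bigr => j _; rewrite rmorphM mulrA.
rewrite big1 // => j _; rewrite -mulr_suml -rmorph_sum kj.
by rewrite rmorph0 mul0r.
Qed.

End Monomials.

Section FiniteModule.
Variables (F : fieldType) (C : comNzRingType) (phi : {rmorphism F -> C}).
Variables (d : nat) (I : finType) (y : nat -> C) (e : I -> C).
Local Notation ev := (teval phi y d).
Hypothesis span : forall z, exists b : I -> tower F d, z = \sum_j ev (b j) * e j.

(* Elements with coordinates of degree below [M]; multiplication by a fixed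
   element raises this bound by a constant only. *)
Let P M z := exists b : I -> tower F d,
  (forall j, tdeg M (b j)) /\ z = \sum_j ev (b j) * e j.

Lemma module_deg_le M N z : (M <= N)%N -> P M z -> P N z.
Proof. by move=> MN [b [hb ->]]; exists b; split=> // j; apply: tdeg_le (hb j). Qed.

Lemma module_deg_sum M (T : finType) (f : T -> C) :
  (forall i, P M (f i)) -> P M (\sum_i f i).
Proof.
move=> /boolp.choice[b hb]; exists (fun j => \sum_i b i j); split.
  by move=> j; apply: tdeg_sum => i; have [] := hb i.
rewrite (eq_bigr _ (fun i _ => proj2 (hb i))) exchange_big /=.
by apply: eq_bigr => j _; rewrite rmorph_sum mulr_suml.
Qed.

Lemma module_degM M N (b : tower F d) z : tdeg M b -> P N z -> P (M + N) (ev b * z).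
Proof.
move=> hb [c [hc ->]]; exists (fun j => b * c j); split.
  by move=> j; apply: tdegM.
by rewrite mulr_sumr; apply: eq_bigr => j _; rewrite rmorphM mulrA.
Qed.

Lemma module_deg_ex z : exists M, P M z.
Proof.
have [b ->] := span z; have [||M hM] := @uniform_bound I (fun j M => tdeg M (b j)).
- by move=> j; apply: tdeg_ex.
- by move=> j M N; apply: tdeg_le.
by exists M, b.
Qed.

Lemma module_mul_deg n (a : nat -> C) :
  exists D, forall l : 'I_n, forall M z, P M z -> P (M + D) (a l * z).
Proof.
have [||D hD] := @uniform_bound ('I_n * I)%type (fun u M => P M (a u.1 * e u.2)).
- by move=> u; apply: module_deg_ex.
- by move=> u M N; apply: module_deg_le.
exists D => l M z [b [hb ->]]; rewrite mulr_sumr; apply: module_deg_sum => j.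
rewrite mulrCA; apply: module_degM => //; exact: (hD (l, j)).
Qed.

Lemma mono_module_deg D D0 n (a : nat -> C) N (u : idx N n) : P D0 1 ->
    (forall l : 'I_n, forall M z, P M z -> P (M + D) (a l * z)) ->
  P (D0 + n * (N * D)) (mono a u).
Proof.
move=> h1; elim: n u => [|n IH] u ha; first by rewrite mul0n addn0.
have {}IH := IH u.2 (fun l => ha (widen_ord (leqnSn n) l)).
have hX k : P (D0 + n * (N * D) + k * D) (a n ^+ k * mono a u.2).
  elim: k => [|k IHk]; first by rewrite mul0n addn0 mul1r.
  rewrite exprS -mulrA mulSn addnCA addnC; exact: (ha ord_max).
apply: module_deg_le (hX u.1); rewrite mulSn addnCA [leqRHS]addnC leq_add2l.
by rewrite leq_mul2r (ltnW (ltn_ord u.1)) orbT.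
Qed.

(** A ring that is finite as a module over a polynomial ring in [d] variables
    has no [d + 1] algebraically independent elements: the number of monomials
    with exponents below [N] in [d + 1] elements grows like [N ^ (d + 1)], the
    dimension of the space that contains them only like [N ^ d]. *)
Lemma algebraic_dependence (a : nat -> C) :
  exists p : tower F d.+1, p != 0 /\ teval phi a d.+1 p = 0.
Proof.
have [D hD] := module_mul_deg d.+1 a.
have [D0 h1] := module_deg_ex 1.
(* The monomials with exponents below [N] have coordinates of degree below
   [N * K], and the exponent [d + 1] beats [d] once [N] exceeds [#|I| * K ^ d]. *)
pose K := (D0 + d.+1 * D)%N; pose N := (#|I| * K ^ d).+1.
pose M := (N * K)%N.
have hmono (u : idx N d.+1) : P M (mono a u).
  apply: module_deg_le (mono_module_deg u h1 hD).
  rewrite /M /K mulnDr leq_add ?leq_pmull //.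
  by rewrite mulnCA.
have [|| l [[u lu] l0]] := @linear_dependence F C phi (idx N d.+1)
    (I * idx M d)%type (fun u => mono a u) (fun v => mono y v.2 * e v.1).
- move=> u; have [b [/(fun h j => build_surj (h j)) hb ->]] := hmono u.
  have [c hc] := boolp.choice hb.
  exists (fun v => c v.1 v.2).
  transitivity (\sum_j \sum_v phi (c j v) * (mono y v * e j)).
    apply: eq_bigr => j _; rewrite hc teval_build mulr_suml.
    by apply: eq_bigr => v _; rewrite mulrA.
  by rewrite pair_bigA.
- rewrite card_prod !card_idx /M expnMn mulnCA expnSr.
  by rewrite ltn_pmul2l ?expn_gt0.
exists (build l); split; last by rewrite teval_build.
by apply: contraNneq lu => /build_eq0 ->.
Qed.

(** In a ring of fractions the elements that separate the primes of a chain may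
    be taken to be numerators, which satisfy a polynomial relation as soon as
    there are [d + 1] of them. *)
Lemma prime_chain_bound (L : comNzRingType) (loc : {rmorphism C -> L}) :
    (forall z, exists a s t, z * loc s = loc a /\ loc s * t = 1) ->
  forall n (p : 'I_n.+1 -> prime_idealr L), prime_chain p -> (n <= d)%N.
Proof.
move=> frac n p pc; rewrite leqNgt; apply/negP => dn.
(* The outermost variable of a tower goes with the smallest prime. *)
pose q i := p (inord (d.+1 - i)).
have /boolp.choice[a ha] : forall i, exists a : C, (i < d.+1)%N ->
    loc a \in q i /\ loc a \notin q i.+1.
  move=> i; have [lti|] := ltnP i d.+1; last by exists 0.
  have [|sub nsub] := pc (inord (d.+1 - i.+1)) (inord (d.+1 - i)).
    by rewrite !inordK; lia.
  have [z [qz qz']] : exists z, z \in q i /\ z \notin q i.+1.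
    apply: contrapT => h; apply: nsub => z qz; apply: contrapT => /negP qz'.
    by apply: h; exists z.
  have [b [s [t [e1 st]]]] := frac z; exists b => _; rewrite -e1; split.
    by rewrite mulrC idealMr.
  apply: contra qz' => h; rewrite -[z]mulr1 -st mulrA mulrC.
  exact: idealMr.
have [f [f0 fE]] := algebraic_dependence a.
have := @chain_no_relation F L (loc \o phi) d.+1 q (loc \o a) _ f.
have -> : teval (loc \o phi) (loc \o a) d.+1 f = loc (teval phi a d.+1 f).
  have := @tower_ext F L d.+1 (teval (loc \o phi) (loc \o a) d.+1) (loc \o teval phi a d.+1).
  apply=> [c|i lti]; first by rewrite /= (tevalC _ _ d.+1) (tevalC _ _ d.+1).
  by rewrite [LHS]tevalX //= (tevalX _ _ lti).
rewrite fE rmorph0 idealr0 => h; move/eqP: f0; apply; apply: h => // i lti.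
have [qa qa'] := ha i lti; split=> //.
have [|sub nsub] := pc (inord (d.+1 - i.+1)) (inord (d.+1 - i)); last exact: sub.
by rewrite !inordK; lia.
Qed.

End FiniteModule.
End Counting.

(** * Nullstellensatz *)

Section Goldman.
Local Open Scope ring_scope.
Variables (C : comNzRingType) (P : prime_idealr C).

(** The image of [D] modulo [P] becomes a field once a single nonzero element
    [s] is inverted.  This property descends from [D[a]] to [D], and it fails
    for a polynomial ring in one variable that embeds in the quotient by [P]. *)
Definition goldman (D : comNzRingType) (phi : {rmorphism D -> C}) :=
  exists s, phi s \notin P /\
    forall r, phi r \notin P -> exists m c, phi (s ^+ m - r * c) \in P.

Lemma notin_primeX x n : x \notin P -> x ^+ n \notin P.
Proof.
move=> Px; elim: n => [|n IH]; first by rewrite idealr1.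
by rewrite exprS prime_idealrM negb_or Px.
Qed.

Lemma maximal_goldman (D : comNzRingType) (phi : {rmorphism D -> C}) :
  maximal P -> (forall z, exists x, phi x = z) -> goldman phi.
Proof.
move=> maxP surj; exists 1; rewrite rmorph1 idealr1; split=> // r Pr.
exists 1%N; suff [z hz] : exists z, 1 - phi r * z \in P.
  by have [c cz] := surj z; exists c; rewrite expr1 rmorphB rmorphM rmorph1 cz.
apply: contrapT => h.
have [||J hJ] :=
    @mk_idealr C (fun x => exists p z, p \in P /\ x = p + phi r * z).
- split; first by exists 0, 0; rewrite idealr0 mulr0 addr0.
  move=> a u v [p [z [Pp ->]]] [p' [z' [Pp' ->]]].
  by exists (a * p + p'), (a * z + z'); split; [rewrite rpredD // idealMr|ring].
- move=> [p [z [Pp e]]]; apply: h; exists z.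
  by rewrite e addrK.
move/negP: Pr; apply; apply: (maxP J) => [x Px|]; apply/hJ.
  by exists x, 0; rewrite mulr0 addr0.
by exists 0, 1; rewrite idealr0 mulr1 add0r.
Qed.

Section Descent.
Variables (D : comNzRingType) (phi : {rmorphism D -> C}) (a : C).
Local Notation psi := (horner_morph (commr_rmorph_all phi a)).
Implicit Types (f g h z : {poly D}) (c r : D).

(* [p] and [q] are the preimages of [P] in [D] and in [D[X]]; [pX] is the
   extension of [p] to [D[X]], contained in [q]. *)
Let p c := phi c \in P.
Let q h := psi h \in P.
Let pX h := forall i, p h`_i.

Lemma pX_q h : pX h -> q h.
Proof.
move=> hp; rewrite /q -[h]coefK poly_def rmorph_sum rpred_sum // => i _.
by rewrite -mul_polyC rmorphM /= horner_morphC mulrC idealMr //; apply: hp.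
Qed.

(** Dropping leading terms with coefficients in [p] leaves, modulo [pX], zero or
    a polynomial whose leading coefficient is outside the prime [p]; such
    leading coefficients multiply as over a domain. *)
Lemma normal_rep h : exists h',
  [/\ (size h' <= size h)%N, pX (h - h') & (h' = 0) \/ (~~ p (lead_coef h'))].
Proof.
have [n] := ubnP (size h); elim: n h => // n IH h; rewrite ltnS => sh.
have [ph|nph] := boolP (p (lead_coef h)); last first.
  by exists h; split; [|move=> i; rewrite subrr coef0 /p rmorph0 idealr0|right].
have [->|h0] := eqVneq h 0.
  by exists 0; split; [|move=> i; rewrite subrr coef0 /p rmorph0 idealr0|left].
pose h1 := h - lead_coef h *: 'X^((size h).-1).
have s1 : (size h1 < size h)%N.
  rewrite -(prednK (_ : 0 < size h)%N) ?size_poly_gt0 // ltnS.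
  apply/leq_sizeP => j; rewrite coefB coefZ coefXn.
  rewrite leq_eqVlt => /orP[/eqP<-|ltj].
    by rewrite eqxx mulr1 subrr.
  rewrite gtn_eqF // mulr0 subr0 nth_default //.
  by rewrite -(prednK (_ : 0 < size h)%N) ?size_poly_gt0.
have [|h' [s' ph' lh']] := IH h1; first exact: leq_trans s1 sh.
exists h'; split=> //; first exact: leq_trans s' (ltnW s1).
move=> i.
have -> : h - h' = (h1 - h') + lead_coef h *: 'X^((size h).-1) by rewrite /h1; ring.
rewrite coefD /p rmorphD rpredD //; first exact: ph'.
by rewrite coefZ rmorphM mulrC idealMr.
Qed.

Lemma pXD f g : pX f -> pX g -> pX (f + g).
Proof. by move=> hf hg i; rewrite coefD /p rmorphD rpredD; [|exact: hf|exact: hg]. Qed.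

Lemma pXM f g : pX f -> pX (g * f).
Proof.
move=> hf i; rewrite coefM /p rmorph_sum rpred_sum // => j _.
by rewrite rmorphM idealMr //; apply: hf.
Qed.

Lemma size_normal_mul f g : ~~ p (lead_coef f) -> ~~ p (lead_coef g) ->
  size (f * g) = (size f + size g).-1 /\ ~~ p (lead_coef (f * g)).
Proof.
move=> hf hg; have h : ~~ p (lead_coef f * lead_coef g).
  by rewrite /p rmorphM prime_idealrM negb_or hf.
have n0 : lead_coef f * lead_coef g != 0.
  by apply: contraNneq h => ->; rewrite /p rmorph0 idealr0.
by rewrite size_proper_mul // lead_coef_proper_mul.
Qed.

Lemma top_coef_pX f g : ~~ p (lead_coef f) -> pX (f - g) -> (size f <= size g)%N.
Proof.
move=> hf hfg; rewrite leqNgt; apply/negP => lt; move/negP: hf; apply.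
have := hfg (size f).-1.
by rewrite coefB [g`_ _]nth_default ?subr0 // -ltnS prednK // (leq_ltn_trans _ lt).
Qed.

(** Otherwise [q = pX], and [D[X]] modulo [q] is a polynomial ring over a domain.
    There [1 + X s] is nonzero, so it divides a power of [s], hence a power of
    [X s]; but [X s] is [-1] modulo [1 + X s], so [1 + X s] is a unit, which its
    positive degree forbids. *)
Lemma goldman_algebraic : goldman psi ->
  exists g, psi g \in P /\ phi (lead_coef g) \notin P.
Proof.
move=> [s [sP hs]]; apply: contrapT => nog.
have qpX h : q h -> pX h.
  move=> qh; have [h' [_ ph' lh']] := normal_rep h.
  have -> : h = h - h' + h' by ring.
  apply: pXD => //; case: lh' => [->|lh'].
    by move=> i; rewrite coef0 /p rmorph0 idealr0.
  exfalso; apply: nog; exists h'; split=> //.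
  have -> : h' = h - (h - h') by ring.
  by rewrite rmorphB rpredB //; apply: pX_q.
pose f := 1 + 'X * s.
have f0 : f`_0 = 1 by rewrite coefD coef1 coefXM addr0.
have [|m [c hm]] := hs f.
  by apply/negP => /qpX/(_ 0%N); rewrite f0 /p rmorph1 idealr1.
have [z hz] : exists z, pX (f * z - 1).
  have [w hw] : exists w, (-1) ^+ m * ('X * s) ^+ m = 1 + f * w.
    elim: (m) => [|k [w IH]]; first by exists 0; rewrite !expr0; ring.
    exists (w - (1 + f * w)); rewrite !exprS.
    transitivity (- ('X * s) * ((-1) ^+ k * ('X * s) ^+ k)); first by ring.
    rewrite IH /f; ring.
  exists ((-1) ^+ m * 'X^m * c - w).
  have -> : f * ((-1) ^+ m * 'X^m * c - w) - 1 =
      - ((-1) ^+ m * 'X^m * (s ^+ m - f * c)) + ((-1) ^+ m * ('X * s) ^+ m - (1 + f * w)).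
    by rewrite exprMn; ring.
  by rewrite hw subrr addr0 -mulNr; apply/pXM/qpX.
have [f' [_ pf lf]] := normal_rep f; have [z' [_ pz lz]] := normal_rep z.
have p1 : ~~ p 1 by rewrite /p rmorph1 idealr1.
have fz : pX (f' * z' - 1).
  have -> : f' * z' - 1 = f * z - 1 + (- z * (f - f') + - f' * (z - z')) by ring.
  by apply: pXD => //; apply: pXD; apply: pXM.
case: lf => [f'0|lf].
  by move: (fz 0%N); rewrite f'0 mul0r sub0r coefN coef1 /p rmorphN rpredN rmorph1 idealr1.
case: lz => [z'0|lz].
  by move: (fz 0%N); rewrite z'0 mulr0 sub0r coefN coef1 /p rmorphN rpredN rmorph1 idealr1.
have [sfz lfz] := size_normal_mul lf lz.
have := top_coef_pX lfz fz; rewrite size_poly1 sfz.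
have sz : (0 < size z')%N.
  rewrite lt0n size_poly_eq0; apply: contraNneq lz => ->.
  by rewrite lead_coef0 /p rmorph0 idealr0.
suff: (1 < size f')%N by lia.
rewrite ltnNge; apply/negP => sf; move/negP: sP; apply; apply/pX_q => i.
have := pf i.+1; rewrite coefB [f'`_ _]nth_default ?subr0.
  by rewrite coefD coef1 coefXM /= add0r.
exact: leq_trans sf _.
Qed.

Lemma pseudo_division d f : d != 0 -> exists m Q rho,
  (lead_coef d ^+ m)%:P * f = Q * d + rho /\ (size rho < size d)%N.
Proof.
move=> d0; exists (Pdiv.Ring.rscalp f d), (Pdiv.Ring.rdivp f d), (Pdiv.Ring.rmodp f d).
by rewrite mul_polyC Pdiv.ComRing.rdivp_eq; split=> //; apply: Pdiv.CommonRing.ltn_rmodpN0.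
Qed.

Lemma min_size_poly (E : {poly D} -> Prop) : (exists f, E f) ->
  exists f, E f /\ forall g, E g -> (size f <= size g)%N.
Proof.
move=> [f Ef].
have ex : exists n, `[< exists2 g, E g & size g = n >].
  by exists (size f); apply/asboolP; exists f.
case: (ex_minnP ex) => n /asboolP[g Eg <-] min; exists g; split=> // h Eh.
by apply: min; apply/asboolP; exists h.
Qed.

Lemma normal_neq0 f : ~~ p (lead_coef f) -> f != 0.
Proof. by apply: contraNneq => ->; rewrite lead_coef0 /p rmorph0 idealr0. Qed.

Section MinimalRelation.
Variable g : {poly D}.
Hypotheses (qg : q g) (lg : ~~ p (lead_coef g)).
Hypothesis ming : forall f, q f -> ~~ p (lead_coef f) -> (size g <= size f)%N.

Let small_pX h : q h -> (size h < size g)%N -> pX h.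
Proof.
move=> qh sh; have [h' [sh' ph' lh']] := normal_rep h.
case: lh' => [h'0|lh']; first by move: ph'; rewrite h'0 subr0.
have : (size g <= size h')%N.
  apply: ming => //; rewrite (_ : h' = h - (h - h')); last by ring.
  by rewrite /q rmorphB rpredB //; apply: pX_q.
by rewrite leqNgt (leq_ltn_trans sh' sh).
Qed.

Let qM f h : q (f * h) = q f || q h.
Proof. by rewrite /q rmorphM prime_idealrM. Qed.

Let qC c : q c%:P = p c.
Proof. by rewrite /q /= horner_morphC. Qed.

Let lead_exp f m : ~~ p (lead_coef f) -> ~~ q (lead_coef f ^+ m)%:P.
Proof. by move=> lf; rewrite qC /p rmorphXn; apply: notin_primeX. Qed.

Let size_g : (1 < size g)%N.
Proof.
rewrite ltnNge; apply/negP => /size1_polyC gE; move: qg lg.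
by rewrite gE qC lead_coefC => ->.
Qed.

(** Over the fraction field of the image of [D], [g] is a minimal polynomial, and
    [h] is invertible modulo [g].  Without fractions: take [f] of least degree
    among the polynomials outside [q] that are multiples of [h] modulo [q].  It
    has smaller degree than [g] and pseudo-divides [g] modulo [pX]; the quotient
    lies in [q], so its degree cannot be smaller than that of [g], and [f] is
    constant. *)
Lemma divides_constant h : ~~ q h -> exists b z, ~~ p b /\ q (b%:P - h * z).
Proof.
move=> qh; pose E f := [/\ ~~ q f, ~~ p (lead_coef f) & exists z, q (f - h * z)].
have normE f z : ~~ q f -> q (f - h * z) ->
    exists f', E f' /\ (size f' <= size f)%N.
  move=> qf qfz; have [f' [sf pf lf]] := normal_rep f.
  have qf' : ~~ q f'.
    apply: contra qf => qf'; rewrite -[f](subrK f') /q rmorphD rpredD //.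
    exact: pX_q.
  exists f'; split=> //; split=> //.
    by case: lf => // f'0; move: qf'; rewrite f'0 /q rmorph0 idealr0.
  exists z; rewrite (_ : f' - _ = f - h * z - (f - f')); last by ring.
  by rewrite /q rmorphB rpredB //; apply: pX_q.
have [|f [[qf lf [z fz]] minf]] := @min_size_poly E.
  have [|f' [Ef' _]] := normE h 1 qh; last by exists f'.
  by rewrite mulr1 subrr /q rmorph0 idealr0.
have sfg : (size f < size g)%N.
  rewrite ltnNge; apply/negP => sgf.
  have [m [Q [rho [e srho]]]] := pseudo_division f (normal_neq0 lg).
  have rhoE : rho = (lead_coef g ^+ m)%:P * f - Q * g by rewrite e; ring.
  have [||f' [Ef' sf']] := normE rho ((lead_coef g ^+ m)%:P * z).
  - rewrite rhoE; apply/negP => h1.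
    have : q ((lead_coef g ^+ m)%:P * f).
      rewrite -[_ * f](subrK (Q * g)) /q rmorphD rpredD //.
      by rewrite -/(q _) qM qg orbT.
    by rewrite qM (negbTE qf) orbF (negbTE (lead_exp _ _)).
  - rewrite rhoE (_ : _ - _ = (lead_coef g ^+ m)%:P * (f - h * z) - Q * g); last by ring.
    by rewrite /q rmorphB rpredB // -/(q _) qM ?fz ?qg orbT.
  have := minf _ Ef'; rewrite leqNgt => /negP; apply.
  exact: leq_ltn_trans sf' (leq_trans srho sgf).
have [m [Z [rho [e srho]]]] := pseudo_division g (normal_neq0 lf).
have rhoE : rho = (lead_coef f ^+ m)%:P * g - Z * f by rewrite e; ring.
have qrho : q rho.
  apply: contraT => qrho.
  have [|f' [Ef' sf']] := normE rho (- Z * z) qrho.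
    rewrite rhoE (_ : _ - _ = (lead_coef f ^+ m)%:P * g - Z * (f - h * z)); last by ring.
    by rewrite /q rmorphB rpredB // -/(q _) qM ?fz ?qg orbT.
  have := minf _ Ef'; rewrite leqNgt => /negP; case.
  exact: leq_ltn_trans sf' srho.
have qZ : q Z.
  have : q (Z * f).
    rewrite (_ : Z * f = (lead_coef f ^+ m)%:P * g - rho); last by rewrite rhoE; ring.
    by rewrite /q rmorphB rpredB // -/(q _) qM qg orbT.
  by rewrite qM (negbTE qf) orbF.
have sf1 : (size f <= 1)%N.
  rewrite leqNgt; apply/negP => sf.
  have [Z' [sZ' pZ lZ]] := normal_rep Z.
  have bg : ~~ p (lead_coef ((lead_coef f ^+ m)%:P)).
    by rewrite lead_coefC -qC lead_exp.
  have [sbg lbg] := size_normal_mul bg lg.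
  have sC : size ((lead_coef f ^+ m)%:P) = 1%N.
    by rewrite size_polyC -polyC_eq0 (normal_neq0 bg).
  rewrite sC add1n /= in sbg.
  have sZg : (size Z' < size g)%N.
    case: lZ => [->|lZ]; first by rewrite size_poly0 (leq_trans _ size_g).
    have [sZf lZf] := size_normal_mul lZ lf.
    have := @top_coef_pX (Z' * f) ((lead_coef f ^+ m)%:P * g - rho) lZf.
    have -> : Z' * f - ((lead_coef f ^+ m)%:P * g - rho) = - f * (Z - Z').
      by rewrite rhoE; ring.
    move=> /(_ (pXM _ pZ)) => h1.
    have h2 : (size ((lead_coef f ^+ m)%:P * g - rho)%R <= size g)%N.
      apply: leq_trans (size_polyD _ _) _; rewrite size_polyN sbg geq_max leqnn.
      exact: ltnW (ltn_trans srho sfg).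
    have := leq_trans h1 h2; rewrite sZf; move: sf; clear; lia.
  have pZ' : pX Z'.
    apply: small_pX => //; rewrite (_ : Z' = Z - (Z - Z')); last by ring.
    by rewrite /q rmorphB rpredB //; apply: pX_q.
  have := @top_coef_pX _ rho lbg; rewrite sbg.
  have -> : (lead_coef f ^+ m)%:P * g - rho = f * (Z - Z') + f * Z' by rewrite rhoE; ring.
  move=> /(_ (pXD (pXM _ pZ) (pXM _ pZ'))).
  by rewrite leqNgt (ltn_trans srho sfg).
exists f`_0, z; rewrite -(size1_polyC sf1); split=> //.
by move: lf; rewrite (size1_polyC sf1) lead_coefC coefC eqxx.
Qed.

(** A constant multiple [s'] of [s] can replace [s]; dividing by [g] then turns a
    relation over [D[X]] into one of degree less than that of [g], whose
    coefficients all lie in [p].  The constant coefficient is the relation over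
    [D]; the denominators are powers of the leading coefficient of [g]. *)
Lemma goldman_descend_minimal : goldman psi -> goldman phi.
Proof.
move=> [s [qs hs]]; have [s' [z [ps' hs']]] := divides_constant qs.
exists (lead_coef g * s'); split.
  by rewrite rmorphM prime_idealrM negb_or; apply/andP.
move=> r Pr; have [|m [y hy]] := hs r%:P; first by rewrite -/(q _) qC.
have [l [Q [Y [e sY]]]] := pseudo_division (y * z ^+ m) (normal_neq0 lg).
have YE : Y = (lead_coef g ^+ l)%:P * (y * z ^+ m) - Q * g by rewrite e; ring.
have [w hw] : exists w, s'%:P ^+ m = (s * z) ^+ m + (s'%:P - s * z) * w.
  exists (\sum_(i < m) s'%:P ^+ (m.-1 - i) * (s * z) ^+ i).
  by rewrite -[LHS](subrK ((s * z) ^+ m)) subrXX addrC.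
pose U := (lead_coef g ^+ l * s' ^+ m)%:P - r%:P * Y.
have qU : q U.
  rewrite (_ : U = (lead_coef g ^+ l)%:P * (z ^+ m * (s ^+ m - r%:P * y))
      + ((lead_coef g ^+ l)%:P * w * (s'%:P - s * z) + r%:P * Q * g)).
    by rewrite /q !rmorphD !rpredD // -/(q _) ?qM ?hs' ?qg ?orbT // /q hy !orbT.
  by rewrite /U YE polyCM [(s' ^+ m)%:P]polyC_exp hw exprMn; ring.
have /(_ 0%N) : pX U.
  apply: small_pX => //; rewrite /U.
  apply: leq_ltn_trans (size_polyD _ _) _; rewrite size_polyN gtn_max.
  rewrite (leq_ltn_trans (size_polyC_leq1 _) size_g) mul_polyC.
  exact: leq_ltn_trans (size_scale_leq _ _) sY.
rewrite coefB coefC eqxx coefCM /p => hU.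
exists (l + m)%N, (lead_coef g ^+ m * s' ^+ l * Y`_0).
rewrite (_ : _ - _ = lead_coef g ^+ m * s' ^+ l *
    (lead_coef g ^+ l * s' ^+ m - r * Y`_0)); first by rewrite rmorphM idealMr.
by rewrite exprMn !exprD; ring.
Qed.

End MinimalRelation.

Lemma goldman_descend : goldman psi -> goldman phi.
Proof.
move=> G; have [g0 [q0 l0]] := goldman_algebraic G.
have [|g [[qg lg] ming]] := @min_size_poly (fun g => q g /\ ~~ p (lead_coef g)).
  by exists g0.
by apply: (@goldman_descend_minimal g) => // f qf lf; apply: ming.
Qed.

End Descent.

Lemma goldman_tower (D : comNzRingType) (phi : {rmorphism D -> C}) a n :
  goldman (teval phi a n) -> goldman phi.
Proof. by elim: n => //= n IH /goldman_descend. Qed.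

(** Zariski's form of the Nullstellensatz: modulo a maximal ideal of an
    affine algebra every element is algebraic. *)
Lemma maximal_algebraic (F : fieldType) (phi : {rmorphism F -> C}) a n y :
    maximal P -> (forall z, exists x, teval phi a n x = z) ->
  exists f : {poly F}, f \is monic /\ (map_poly phi f).[y] \in P.
Proof.
move=> maxP surj; pose phi1 : {rmorphism {poly F} -> C} := horner_morph (commr_rmorph_all phi y).
have surj1 z : exists x, teval phi1 a n x = z.
  have [x <-] := surj z.
  exists (teval (tC {poly F} n \o polyC) (tX {poly F} n) n x).
  pose f := teval phi1 a n \o teval (tC {poly F} n \o polyC) (tX {poly F} n) n.
  apply: (@tower_ext F C n f (teval phi a n)) => [c|i lti] /=.
    by rewrite !tevalC /= horner_morphC.
  by rewrite !tevalX.
have /goldman_tower/goldman_algebraic[g [Pg lg]] := maximal_goldman maxP surj1.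
have g0 : lead_coef g != 0 by apply: contraNneq lg => ->; rewrite rmorph0 idealr0.
exists ((lead_coef g)^-1 *: g); split; first by rewrite monicE lead_coefZ mulVf.
have : phi1 ((lead_coef g)^-1%:P * g) \in P by rewrite rmorphM idealMr.
by rewrite mul_polyC.
Qed.

End Goldman.

(** * A Cohen-Macaulay criterion *)

Section WeaklyRegular.
Local Open Scope ring_scope.

(** Regularity without the condition that the sequence generates a proper ideal:
    this part is inherited by extensions in which the ideal may become trivial. *)
Definition weakly_regular (A : comNzRingType) (s : seq A) :=
  forall i, (i < size s)%N -> forall x,
    s`_i * x \in ideal_gen (take i s) -> x \in ideal_gen (take i s).

Lemma weakly_regular_rcons (A : comNzRingType) (s : seq A) y :
  weakly_regular s -> (forall x, y * x \in ideal_gen s -> x \in ideal_gen s) ->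
  weakly_regular (rcons s y).
Proof.
move=> ws hy i; rewrite size_rcons ltnS leq_eqVlt => /orP[/eqP->|lti] x.
  by rewrite nth_rcons ltnn eqxx -cats1 take_size_cat // => /hy.
by rewrite nth_rcons lti -cats1 takel_cat ?(ltnW lti) // => /(ws i lti).
Qed.

Lemma ideal_gen_polyC (A : comNzRingType) (s : seq A) (p : {poly A}) :
  p \in ideal_gen (map polyC s) <-> forall i, p`_i \in ideal_gen s.
Proof.
have [g0 gl] := ideal_gen_ideal s.
split=> [|h].
  apply: (@ideal_gen_min _ (fun p : {poly A} => forall i, p`_i \in ideal_gen s)).
    split=> [i|a x y hx hy i]; first by rewrite coef0.
    rewrite coefD coefM; apply: (is_idealD (ideal_gen_ideal s)) => //.
    apply: (is_ideal_sum (J := fun x => x \in ideal_gen s)) => [|j _].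
      exact: ideal_gen_ideal.
    exact: (is_idealMl _ (ideal_gen_ideal s)).
  move=> _ /mapP[x sx ->] i; rewrite coefC; case: ifP => // _.
  exact: mem_ideal_gen.
rewrite -[p]coefK poly_def.
have idg := ideal_gen_ideal (map polyC s).
apply: (is_ideal_sum (J := fun x => x \in ideal_gen (map polyC s))) => // i _.
rewrite -mul_polyC mulrC; apply: (is_idealMl _ idg).
apply: (@ideal_gen_min _ (fun x => x%:P \in ideal_gen (map polyC s))) (h i).
  split=> [|a x y hx hy]; first by rewrite polyC0; case: idg.
  by rewrite polyCD polyCM; case: idg => _; apply.
by move=> x sx; apply/mem_ideal_gen/map_f.
Qed.

(** A monic polynomial is a nonzerodivisor modulo an ideal of constants. *)
Lemma monic_coef_ideal (A : comNzRingType) (J : A -> Prop) (g p : {poly A}) :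
  is_ideal J -> g \is monic -> (forall i, J (g * p)`_i) -> forall i, J p`_i.
Proof.
move=> idJ mg; have [n] := ubnP (size p); elim: n p => // n IH p.
rewrite ltnS => sp gp.
have [->|p0] := eqVneq p 0; first by move=> i; rewrite coef0; case: idJ.
have sp0 : (0 < size p)%N by rewrite size_poly_gt0.
have Jl : J (lead_coef p).
  by rewrite -(lead_coef_Mmonic p mg) /lead_coef mulrC.
have JX i : J (lead_coef p *: 'X^((size p).-1))`_i.
  by rewrite coefZ mulrC; apply: is_idealMl.
pose p1 := p - lead_coef p *: 'X^((size p).-1).
have s1 : (size p1 < size p)%N.
  rewrite -(prednK sp0) ltnS; apply/leq_sizeP => j; rewrite coefB coefZ coefXn.
  rewrite leq_eqVlt => /orP[/eqP<-|ltj].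
    by rewrite eqxx mulr1 subrr.
  by rewrite gtn_eqF // mulr0 subr0 nth_default // -(prednK sp0).
move=> i; have -> : p = p1 + lead_coef p *: 'X^((size p).-1) by rewrite /p1; ring.
rewrite coefD; apply: is_idealD => //; apply: IH => [|k].
  exact: leq_trans s1 sp.
rewrite mulrBr coefB; apply: is_idealB => //.
by rewrite coefM; apply: is_ideal_sum => // j _; apply: is_idealMl.
Qed.

Lemma weakly_regular_polyC (A : comNzRingType) (s : seq A) :
  weakly_regular s -> weakly_regular (map polyC s).
Proof.
move=> ws i; rewrite size_map => lti x; rewrite (nth_map 0) // -map_take.
move=> /ideal_gen_polyC h; apply/ideal_gen_polyC => j; apply: ws => //.
by have := h j; rewrite coefCM.
Qed.

(** Each new polynomial is monic in a new variable, modulo an ideal generated by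
    constants with respect to that variable. *)
Lemma tower_weakly_regular (F : fieldType) (f : nat -> {poly F}) d :
  (forall i, f i \is monic) ->
  weakly_regular [seq (map_poly (tC F d) (f i)).[tX F d i] | i <- iota 0 d].
Proof.
move=> mf; elim: d => [|d IH] //.
rewrite -[d.+1]addn1 iotaD map_cat cats1 add0n addn1 /=.
set s := (X in rcons X _).
have -> : s = map polyC [seq (map_poly (tC F d) (f i)).[tX F d i] | i <- iota 0 d].
  rewrite -map_comp; apply/eq_in_map => i; rewrite mem_iota add0n => /andP[_ lti] /=.
  by rewrite (ltn_eqF lti) -horner_map map_poly_comp.
rewrite eqxx map_poly_comp -[_.['X]]/(_ \Po 'X) comp_polyXr.
apply: weakly_regular_rcons; first exact: weakly_regular_polyC.
move=> x /ideal_gen_polyC h; apply/ideal_gen_polyC.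
apply: (@monic_coef_ideal _ (fun x => x \in ideal_gen _) (map_poly (tC F d) (f d))) => //.
  exact: ideal_gen_ideal.
exact: monic_map.
Qed.

(** The polynomials that express the algebraicity of the parameters modulo a
    maximal ideal form a regular sequence of length [d], and finiteness bounds
    the dimension by [d]. *)
Theorem CM_of_finite_flat (F : fieldType) (C : comNzRingType)
    (phi : {rmorphism F -> C}) (n d : nat) (I : finType) (a y : nat -> C) (e : I -> C) :
    (forall z, exists x, teval phi a n x = z) ->
    (forall z, exists b : I -> tower F d, z = \sum_j teval phi y d (b j) * e j) ->
    (forall s, weakly_regular s -> weakly_regular (map (teval phi y d) s)) ->
  cohen_macaulay C.
Proof.
move=> surj span flat; split.
  apply: all_ideals_fg_noetherian.
  exact: (surj_all_ideals_fg surj (@tower_all_ideals_fg F n)).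
move=> P maxP.
have /boolp.choice[f hf] := fun i => maximal_algebraic (y i) maxP surj.
have mf i : f i \is monic by case: (hf i).
apply: (@CM_local_loc C P d
  (map (teval phi y d) [seq (map_poly (tC F d) (f i)).[tX F d i] | i <- iota 0 d])).
- move=> m p; apply: (prime_chain_bound span (loc := loc P)) => z.
  have [b [s [Ps e1]]] := loc_frac z; have [t st] := loc_unit Ps.
  by exists b, s, t.
- move=> _ /mapP[_ /mapP[i + ->] ->]; rewrite mem_iota => /andP[_ lti].
  rewrite -horner_map -map_poly_comp /= tevalX //.
  rewrite (eq_map_poly (g := phi)); first by case: (hf i).
  by move=> c /=; rewrite tevalC.
- by rewrite !size_map size_iota.
- by apply/flat/tower_weakly_regular.
Qed.

End WeaklyRegular.
(** * Ideals of minors *)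

Section HilbertBurch.
Local Open Scope ring_scope.
Variable R : comNzRingType.

(** Hilbert-Burch exactness modulo [J], when the ideal of the minors contains a
    sequence [p, q] that is regular modulo [J].  By Cramer's rule both [p c] and
    [q c] are combinations of the rows [u] and [v].  The two expressions of
    [p q c] agree, because the rows are independent; so [q] times the
    coefficients for [p] is divisible by [p], and by regularity these
    coefficients themselves are. *)
Lemma hilbert_burch (J : R -> Prop) (u1 u2 u3 v1 v2 v3 a1 a2 a3 b1 b2 b3 c1 c2 c3 p q : R) :
  let w1 := u2 * v3 - u3 * v2 in
  let w2 := u3 * v1 - u1 * v3 in
  let w3 := u1 * v2 - u2 * v1 in
  is_ideal J ->
  p = a1 * w1 + a2 * w2 + a3 * w3 ->
  q = b1 * w1 + b2 * w2 + b3 * w3 ->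
  (forall x, J (p * x) -> J x) ->
  (forall x y, J (q * x - p * y) -> exists z, J (x - z * p)) ->
  J (c1 * w1 + c2 * w2 + c3 * w3) ->
  exists s t, [/\ J (c1 - (s * u1 + t * v1)), J (c2 - (s * u2 + t * v2))
                & J (c3 - (s * u3 + t * v3))].
Proof.
move=> w1 w2 w3 idJ pE qE Jp Jq Jc.
have JD := is_idealD idJ; have JM x y Jy := @is_idealMl _ J x y idJ Jy.
have JN x Jx := @is_idealN _ J x idJ Jx.
(* Cramer's rule: the determinant of [x, u, v] times [c] is the determinant of
   [c, u, v] times [x], plus [al x] times [u], plus [be x] times [v]. *)
pose al x1 x2 x3 := x1 * (c2 * v3 - c3 * v2) + x2 * (c3 * v1 - c1 * v3) + x3 * (c1 * v2 - c2 * v1).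
pose be x1 x2 x3 := x1 * (u2 * c3 - u3 * c2) + x2 * (u3 * c1 - u1 * c3) + x3 * (u1 * c2 - u2 * c1).
pose s0 := al a1 a2 a3; pose t0 := be a1 a2 a3.
pose s1 := al b1 b2 b3; pose t1 := be b1 b2 b3.
have E1 : J (p * c1 - (s0 * u1 + t0 * v1)).
  have -> : p * c1 - (s0 * u1 + t0 * v1) = a1 * (c1 * w1 + c2 * w2 + c3 * w3).
    by rewrite pE /s0 /t0 /al /be /w1 /w2 /w3; ring.
  exact: JM.
have E2 : J (p * c2 - (s0 * u2 + t0 * v2)).
  have -> : p * c2 - (s0 * u2 + t0 * v2) = a2 * (c1 * w1 + c2 * w2 + c3 * w3).
    by rewrite pE /s0 /t0 /al /be /w1 /w2 /w3; ring.
  exact: JM.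
have E3 : J (p * c3 - (s0 * u3 + t0 * v3)).
  have -> : p * c3 - (s0 * u3 + t0 * v3) = a3 * (c1 * w1 + c2 * w2 + c3 * w3).
    by rewrite pE /s0 /t0 /al /be /w1 /w2 /w3; ring.
  exact: JM.
(* The coefficients of the difference of the two expressions of [p q c]; they
   vanish modulo [J] because the minors annihilate them. *)
pose A := q * s0 - p * s1; pose B := q * t0 - p * t1.
have G1 : J (A * u1 + B * v1).
  have -> : A * u1 + B * v1 = (p * b1 - q * a1) * (c1 * w1 + c2 * w2 + c3 * w3).
    by rewrite /A /B pE qE /s0 /t0 /s1 /t1 /al /be /w1 /w2 /w3; ring.
  exact: JM.
have G2 : J (A * u2 + B * v2).
  have -> : A * u2 + B * v2 = (p * b2 - q * a2) * (c1 * w1 + c2 * w2 + c3 * w3).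
    by rewrite /A /B pE qE /s0 /t0 /s1 /t1 /al /be /w1 /w2 /w3; ring.
  exact: JM.
have G3 : J (A * u3 + B * v3).
  have -> : A * u3 + B * v3 = (p * b3 - q * a3) * (c1 * w1 + c2 * w2 + c3 * w3).
    by rewrite /A /B pE qE /s0 /t0 /s1 /t1 /al /be /w1 /w2 /w3; ring.
  exact: JM.
have /Jq[z hz] : J A.
  apply: Jp.
  have -> : p * A = (a3 * v2 - a2 * v3) * (A * u1 + B * v1)
     + ((a1 * v3 - a3 * v1) * (A * u2 + B * v2) + (a2 * v1 - a1 * v2) * (A * u3 + B * v3)).
    by rewrite pE /w1 /w2 /w3; ring.
  by apply: (JD) => //; [|apply: (JD)]; apply: (JM).
have /Jq[z' hz'] : J B.
  apply: Jp.
  have -> : p * B = (a2 * u3 - a3 * u2) * (A * u1 + B * v1)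
     + ((a3 * u1 - a1 * u3) * (A * u2 + B * v2) + (a1 * u2 - a2 * u1) * (A * u3 + B * v3)).
    by rewrite pE /w1 /w2 /w3; ring.
  by apply: (JD) => //; [|apply: (JD)]; apply: (JM).
have fin c u v : J (p * c - (s0 * u + t0 * v)) -> J (c - (z * u + z' * v)).
  move=> E; apply: Jp.
  have -> : p * (c - (z * u + z' * v)) =
     (p * c - (s0 * u + t0 * v)) + (u * (s0 - z * p) + v * (t0 - z' * p)) by ring.
  by apply: (JD) => //; apply: (JD); apply: (JM).
by exists z, z'; split; apply: fin.
Qed.
End HilbertBurch.

Section Determinantal.
Local Open Scope ring_scope.
Variables (B C : comNzRingType) (Theta : {rmorphism {poly {poly B}} -> C}).
Local Notation R := {poly {poly B}}.
Local Notation cst := (polyC \o polyC).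
Variables (u1 u2 u3 v1 v2 v3 : R).
Let w1 := u2 * v3 - u3 * v2.
Let w2 := u3 * v1 - u1 * v3.
Let w3 := u1 * v2 - u2 * v1.
Hypothesis surj : forall z, exists x, Theta x = z.
Hypothesis kerE : forall x, Theta x = 0 <->
  exists c1 c2 c3, x = c1 * w1 + c2 * w2 + c3 * w3.

Let ext (t : seq B) := ideal_gen (map cst t : seq R).

Lemma ext_coef t (p : R) : p \in ext t <-> forall i j, p`_i`_j \in ideal_gen t.
Proof.
rewrite /ext map_comp; split=> [/ideal_gen_polyC h i|h].
  by apply/ideal_gen_polyC/h.
by apply/ideal_gen_polyC => i; apply/ideal_gen_polyC.
Qed.

Lemma gen_Theta t x :
  Theta x \in ideal_gen (map (Theta \o cst) t) <->
  exists2 k, k \in ext t & Theta (x - k) = 0.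
Proof.
have idg := ideal_gen_ideal (map (Theta \o cst) t).
have ide := ideal_gen_ideal (map cst t : seq R).
split=> [|[k kt]].
  move=> zt.
  have [k [kt kx]] : exists k, k \in ext t /\ Theta k = Theta x.
    apply: (@ideal_gen_min _ (fun z => exists k, k \in ext t /\ Theta k = z)) zt.
      split; first by exists 0; rewrite rmorph0; split=> //; case: ide.
      move=> c a b [k [kt <-]] [l [lt <-]]; have [d <-] := surj c.
      exists (d * k + l); rewrite rmorphD rmorphM; split=> //.
      by case: ide => _; apply.
    move=> _ /mapP[b bt ->]; exists (cst b); split=> //.
    exact/mem_ideal_gen/map_f.
  by exists k => //; rewrite rmorphB kx subrr.
rewrite rmorphB => /eqP; rewrite subr_eq0 => /eqP->.
apply: (@ideal_gen_min _ (fun k => Theta k \in ideal_gen (map (Theta \o cst) t))) kt.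
  split=> [|c a b ha hb]; first by rewrite rmorph0; case: idg.
  by rewrite rmorphD rmorphM; case: idg => _; apply.
by move=> _ /mapP[b bt ->]; apply/mem_ideal_gen/(map_f (Theta \o cst)).
Qed.

(** Write [t] for the elements of [s] that precede [f].  If [f x] is a combination
    of the minors modulo [t], its coefficients form a syzygy of the minors modulo
    [t] and [f].  Up to combinations of the rows, which contribute nothing to the
    value, these coefficients are divisible by [f] modulo [t]; and [f] can be
    cancelled, since it is a nonzerodivisor modulo [t] on coefficients. *)
Lemma determinantal_flat (g : R) (h : {poly B}) :
    g \is monic -> h \is monic -> Theta g = 0 -> Theta h%:P = 0 ->
  forall s, weakly_regular s -> weakly_regular (map (Theta \o cst) s).
Proof.
move=> mg mh /kerE[a1 [a2 [a3 gE]]] /kerE[b1 [b2 [b3 hE]]] s ws i.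
rewrite size_map => lti z; rewrite (nth_map 0) // -map_take.
have [x <-] := surj z; set t := take i s; set f := s`_i => /= hfx.
have /gen_Theta[k kt] : Theta (cst f * x) \in ideal_gen (map (Theta \o cst) t).
  by rewrite rmorphM.
move/kerE => [c1 [c2 [c3 cE]]].
pose J (p : R) := p \in ext (rcons t f).
have idJ : is_ideal J := ideal_gen_ideal _.
have idt : is_ideal (fun p => p \in ext t) := ideal_gen_ideal _.
have Jh p : J (h%:P * p) -> J p.
  move=> /ext_coef hp; apply/ext_coef => m.
  apply: (@monic_coef_ideal _ (fun x => x \in ideal_gen (rcons t f)) h) => //.
    exact: ideal_gen_ideal.
  by move=> j; have := hp m j; rewrite coefCM.
have Jg p p' : J (g * p - h%:P * p') -> exists q, J (p - q * h%:P).
  move=> /ext_coef hp.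
  pose L (l : {poly B}) := exists q, forall j, (l - q * h)`_j \in ideal_gen (rcons t f).
  have [g0 gl] := ideal_gen_ideal (rcons t f).
  have /boolp.choice[q hq] : forall m, L p`_m.
    apply: (@monic_coef_ideal _ L g) => // [|m].
      split; first by exists 0 => j; rewrite mul0r subrr coef0.
      move=> c l l' [q hq] [q' hq']; exists (c * q + q') => j.
      rewrite (_ : _ - _ = c * (l - q * h) + (l' - q' * h)); last by ring.
      move: j; apply/ideal_gen_polyC.
      have [_] := ideal_gen_ideal (map polyC (rcons t f)); apply.
        exact/ideal_gen_polyC.
      exact/ideal_gen_polyC.
    by exists p'`_m => j; have := hp m j; rewrite coefB coefCM [h * _]mulrC.
  exists (\poly_(m < size p) q m); apply/ext_coef => m j.
  rewrite coefB coefMC coef_poly; case: ltnP => [_|ge]; first exact: hq.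
  have p0 : p`_m = 0 := nth_default 0 ge.
  by rewrite p0 mul0r subrr coef0; case: (ideal_gen_ideal (rcons t f)).
have [|s0 [t0 [J1 J2 J3]]] := @hilbert_burch R J u1 u2 u3 v1 v2 v3 b1 b2 b3 a1 a2 a3
    c1 c2 c3 h%:P g idJ hE gE Jh Jg.
  rewrite -cE; apply: (@is_idealB _ J) => //.
    rewrite mulrC; apply: (@is_idealMl _ J) => //; rewrite /J.
    by apply: mem_ideal_gen; apply: map_f; rewrite mem_rcons mem_head.
  by apply: sub_ideal_gen kt; move=> y /mapP[b bt ->]; apply/map_f; rewrite mem_rcons inE bt orbT.
have split_J p : J p -> exists d, p - d * cst f \in ext t.
  by rewrite /J /ext map_rcons => /ideal_gen_rcons[d hd]; exists d.
have [d1 k1] := split_J _ J1; have [d2 k2] := split_J _ J2; have [d3 k3] := split_J _ J3.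
apply/gen_Theta; exists (x - (d1 * w1 + d2 * w2 + d3 * w3)); last first.
  apply/kerE; exists d1, d2, d3; ring.
have : cst f * (x - (d1 * w1 + d2 * w2 + d3 * w3)) \in ext t.
  set k1' := (X in X \in _) in k1; set k2' := (X in X \in _) in k2; set k3' := (X in X \in _) in k3.
  rewrite (_ : _ * _ = k + (w1 * k1' + (w2 * k2' + w3 * k3'))).
    by apply: (is_idealD idt) => //; apply: (is_idealD idt); [|apply: (is_idealD idt)]; apply: (is_idealMl _ idt).
  have -> : cst f * (x - (d1 * w1 + d2 * w2 + d3 * w3)) =
    (cst f * x - k) + k - cst f * (d1 * w1 + d2 * w2 + d3 * w3) by ring.
  by rewrite cE /k1' /k2' /k3' /w1 /w2 /w3; ring.
move=> /ext_coef hc; apply/ext_coef => m j; apply: ws => //.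
by have := hc m j; rewrite /= !coefCM.
Qed.

End Determinantal.

Section FiniteIntegral.
Local Open Scope ring_scope.

(** The Cayley-Hamilton argument: multiplication by [y] is given on a finite
    generating set by a matrix [M]; the determinant of [y - M] kills the
    generators, hence [1]. *)
Lemma finite_integral (B C : comNzRingType) (theta : {rmorphism B -> C})
    (I : finType) (e : I -> C) (y : C) :
    (forall z, exists b : I -> B, z = \sum_i theta (b i) * e i) ->
  exists h : {poly B}, h \is monic /\ (map_poly theta h).[y] = 0.
Proof.
move=> span; have /boolp.choice[b hb] := fun i => span (y * e i).
pose M := \matrix_(i < #|I|, j < #|I|) b (enum_val i) (enum_val j).
exists (char_poly M); split; first exact: char_poly_monic.
pose f : {rmorphism {poly B} -> C} := horner_morph (commr_rmorph_all theta y).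
rewrite -[LHS]/(f _) /char_poly -det_map_mx.
set N := map_mx f _; pose v := \col_(i < #|I|) e (enum_val i).
have sum_enum (F : I -> C) : \sum_i F i = \sum_(k < #|I|) F (enum_val k).
  rewrite (reindex (fun k : 'I_#|I| => enum_val k)) //.
  by exists enum_rank => u _; [apply: enum_valK|apply: enum_rankK].
have Nv : N *m v = 0.
  apply/colP => i; rewrite !mxE.
  transitivity (\sum_j ((y *+ (i == j)) * e (enum_val j)
       - theta (b (enum_val i) (enum_val j)) * e (enum_val j))).
    apply: eq_bigr => j _; rewrite !mxE rmorphB rmorphMn /= horner_morphX.
    by rewrite horner_morphC mulrBl.
  rewrite sumrB (bigD1 i) //= eqxx big1 ?addr0.
    by rewrite mulr1n hb sum_enum subrr.
  by move=> j ji; rewrite eq_sym (negbTE ji) mulr0n mul0r.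
have dete i : \det N * e i = 0.
  have := congr1 (fun w : 'cV_ #|I| => w (enum_rank i) 0) (congr1 (mulmx (\adj N)) Nv).
  rewrite mulmxA mul_adj_mx mul_scalar_mx mulmx0 !mxE enum_rankK; exact.
have [c c1] := span 1; rewrite -[\det N]mulr1 c1 mulr_sumr big1 // => i _.
by rewrite mulrCA dete mulr0.
Qed.

End FiniteIntegral.

Section Filtration.
Local Open Scope ring_scope.
Variable B : comNzRingType.
Local Notation R := {poly {poly B}}.
Local Notation X := ('X : R).
Local Notation Y := ('X%:P : R).
Implicit Types p q : R.

(** The total degree in the two variables [X] and [Y]; elements of [B] have
    degree zero, and only [0] has degree less than zero. *)
Definition deg_lt n p := forall i j, (n <= i + j)%N -> p`_i`_j = 0.

Lemma deg_lt0 n : deg_lt n 0.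
Proof. by move=> i j _; rewrite !coef0. Qed.

Lemma deg_ltD n p q : deg_lt n p -> deg_lt n q -> deg_lt n (p + q).
Proof. by move=> hp hq i j le; rewrite !coefD hp // hq // addr0. Qed.

Lemma deg_ltN n p : deg_lt n p -> deg_lt n (- p).
Proof. by move=> hp i j le; rewrite !coefN hp // oppr0. Qed.

Lemma deg_ltB n p q : deg_lt n p -> deg_lt n q -> deg_lt n (p - q).
Proof. by move=> hp hq; apply/deg_ltD/deg_ltN. Qed.

Lemma deg_lt_le m n p : (m <= n)%N -> deg_lt m p -> deg_lt n p.
Proof. by move=> mn hp i j le; apply: hp; apply: leq_trans le. Qed.

Lemma deg_ltM m n p q : deg_lt m.+1 p -> deg_lt n q -> deg_lt (m + n) (p * q).
Proof.
move=> hp hq i j le; rewrite coefM coef_sum big1 // => a _.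
rewrite coefM big1 // => b _.
have [h|h] := leqP m.+1 (a + b); first by rewrite hp // mul0r.
rewrite [X in _ * X]hq ?mulr0 //.
have := ltn_ord a; have := ltn_ord b; lia.
Qed.

Lemma deg_ltX : deg_lt 2 X.
Proof.
move=> i j le; rewrite coefX; case: eqP => [ei|_]; last by rewrite coef0.
by rewrite coef1; case: j le => [|j] //; rewrite ei addn0.
Qed.

Lemma deg_ltY : deg_lt 2 Y.
Proof.
move=> i j le; rewrite coefC; case: eqP => [ei|_]; last by rewrite coef0.
by rewrite coefX; case: eqP le => // ->; rewrite ei.
Qed.

Lemma deg_lt_cst b : deg_lt 1 (b%:P%:P : R).
Proof.
move=> i j le; rewrite coefC; case: eqP => [ei|_]; last by rewrite coef0.
by rewrite coefC; case: eqP le => // ->; rewrite ei.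
Qed.

Lemma deg_ltXn n p : deg_lt 2 p -> deg_lt n.+1 (p ^+ n).
Proof.
move=> hp; elim: n => [|n IH]; first by rewrite expr0; apply: (deg_lt_cst 1).
by rewrite exprS; apply: (@deg_ltM 1 n.+1).
Qed.

Lemma monic_Xn_lower n p : deg_lt n p -> 'X^n + p \is monic.
Proof.
move=> hp; have sp : (size p <= n)%N.
  apply/leq_sizeP => i le; apply/polyP => j; rewrite coef0 hp //.
  exact: leq_trans le (leq_addr _ _).
by rewrite monicE lead_coefDl ?lead_coefXn // size_polyXn ltnS.
Qed.

Lemma deg_lt_monomials (S : R -> Prop) n :
    S 0 -> (forall p q, S p -> S q -> S (p + q)) ->
    (forall b i j, (i + j < n)%N -> S (b%:P%:P * (Y ^+ j * X ^+ i))) ->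
  forall p, deg_lt n p -> S p.
Proof.
move=> S0 SD SX p hp; rewrite -[p]coefK poly_def.
apply: (big_ind S) => // i _; rewrite -mul_polyC.
rewrite -[p`_i]coefK poly_def rmorph_sum mulr_suml.
apply: (big_ind S) => // j _.
have [lt|ge] := ltnP (i + j) n; last by rewrite hp // scale0r mul0r.
by rewrite -mul_polyC rmorphM rmorphXn /= -mulrA; apply: SX.
Qed.

End Filtration.

Section FiniteQuotient.
Local Open Scope ring_scope.
Variables (B C : comNzRingType) (Theta : {rmorphism {poly {poly B}} -> C}).
Local Notation R := {poly {poly B}}.
Local Notation cst := (polyC \o polyC).
Local Notation X := ('X : R).
Local Notation Y := ('X%:P : R).

(** Any other monomial is divisible by [X^m] or [Y^n], hence congruent to a
    polynomial of smaller total degree. *)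
Lemma finite_quotient m n (f g : R) : (forall z, exists p, Theta p = z) ->
    deg_lt m f -> deg_lt n g -> Theta (X ^+ m + f) = 0 -> Theta (Y ^+ n + g) = 0 ->
  forall z, exists b : 'I_m * 'I_n -> B,
    z = \sum_u Theta (cst (b u)) * Theta (Y ^+ u.2 * X ^+ u.1).
Proof.
move=> surj hf hg f0 g0 z.
pose S p := exists b : 'I_m * 'I_n -> B,
  Theta p = \sum_u Theta (cst (b u)) * Theta (Y ^+ u.2 * X ^+ u.1).
have cstD c d : Theta (cst (c + d)) = Theta (cst c) + Theta (cst d) := rmorphD (Theta \o cst) c d.
have cstM c d : Theta (cst (c * d)) = Theta (cst c) * Theta (cst d) := rmorphM (Theta \o cst) c d.
have S0 : S 0.
  exists (fun=> 0); rewrite rmorph0 big1 // => u _.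
  by rewrite mul0r.
have SD p q : S p -> S q -> S (p + q).
  move=> [b hb] [c hc]; exists (fun u => b u + c u); rewrite rmorphD hb hc -big_split.
  by apply: eq_bigr => u _; rewrite cstD mulrDl.
have SC b p : S p -> S (cst b * p).
  move=> [c hc]; exists (fun u => b * c u); rewrite rmorphM hc mulr_sumr.
  by apply: eq_bigr => u _; rewrite cstM mulrA.
have SE p q : Theta p = Theta q -> S p -> S q by move=> e [b hb]; exists b; rewrite -e.
have SN p : S p -> S (- p).
  move=> Sp; rewrite (_ : - p = cst (-1) * p); first exact: SC.
  by rewrite /= !polyCN mulN1r.
suff all k p : deg_lt k p -> S p.
  have [p <-] := surj z.
  have [M hM] : exists M, forall i : 'I_(size p), (size (p`_i)%R <= M)%N.
    apply: (@uniform_bound _ (fun (i : 'I_(size p)) M => size (p`_i)%R <= M)%N).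
      by move=> i; exists (size p`_i).
    by move=> i M N le h; apply: leq_trans le.
  apply: (all (size p + M)%N) => i j le.
  have [lt|ge] := ltnP i (size p); last by rewrite (nth_default 0 ge) coef0.
  have h := hM (Ordinal lt); rewrite nth_default //=.
  by apply: leq_trans h _; rewrite -(leq_add2l i) (leq_trans _ le) // leq_add2r ltnW.
have [K] := ubnP k; elim: K k p => // K IH k p; rewrite ltnS => kK.
apply: deg_lt_monomials => // b i j ij; apply: SC.
have low p' : deg_lt (i + j) p' -> S p'.
  by apply: IH; apply: leq_trans ij kK.
have [im|im] := leqP m i.
  apply: (SE (- (Y ^+ j * X ^+ (i - m) * f))).
    have -> : Y ^+ j * X ^+ i =
        Y ^+ j * X ^+ (i - m) * (X ^+ m + f) - Y ^+ j * X ^+ (i - m) * f.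
      by rewrite -{1}(subnK im) exprD; ring.
    by rewrite rmorphB [Theta (_ * (_ + _))]rmorphM f0 mulr0 sub0r rmorphN.
  apply/SN/low; rewrite (_ : (i + j = (j + (i - m)) + m)%N); last by lia.
  apply: (@deg_ltM _ (j + (i - m)) m) => //.
  rewrite -addnS; apply: (@deg_ltM _ j); apply: deg_ltXn.
    exact: deg_ltY.
  exact: deg_ltX.
have [jn|jn] := leqP n j.
  apply: (SE (- (Y ^+ (j - n) * X ^+ i * g))).
    have -> : Y ^+ j * X ^+ i =
        Y ^+ (j - n) * X ^+ i * (Y ^+ n + g) - Y ^+ (j - n) * X ^+ i * g.
      by rewrite -{1}(subnK jn) exprD; ring.
    by rewrite rmorphB [Theta (_ * (_ + _))]rmorphM g0 mulr0 sub0r rmorphN.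
  apply/SN/low; rewrite (_ : (i + j = ((j - n) + i) + n)%N); last by lia.
  apply: (@deg_ltM _ ((j - n) + i) n) => //.
  rewrite -addnS; apply: (@deg_ltM _ (j - n)); apply: deg_ltXn.
    exact: deg_ltY.
  exact: deg_ltX.
exists (fun u => (u == (Ordinal im, Ordinal jn))%:R).
rewrite (bigD1 (Ordinal im, Ordinal jn)) //= eqxx !polyC1 rmorph1 mul1r big1 ?addr0 //.
by move=> u /negbTE ->; rewrite /= !polyC0 rmorph0 mul0r.
Qed.

End FiniteQuotient.

Section CMDeterminantal.
Local Open Scope ring_scope.

(** Both leading forms serve for finiteness.  For flatness, [X^m + f] is monic in
    [X], and a second element of the ideal, monic in [Y] and free of [X], comes
    from the integrality of [Y]; together they form a regular sequence modulo
    every ideal of [B]. *)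
Theorem CM_determinantal (F : fieldType) (d : nat) (C : comNzRingType)
    (Theta : {rmorphism {poly {poly tower F d}} -> C})
    (u1 u2 u3 v1 v2 v3 f g : {poly {poly tower F d}}) m n :
    (forall z, exists x, Theta x = z) ->
    (forall x, Theta x = 0 <-> exists c1 c2 c3,
      x = c1 * (u2 * v3 - u3 * v2) + c2 * (u3 * v1 - u1 * v3) + c3 * (u1 * v2 - u2 * v1)) ->
    deg_lt m f -> deg_lt n g ->
    Theta ('X ^+ m + f) = 0 -> Theta ('X%:P ^+ n + g) = 0 ->
  cohen_macaulay C.
Proof.
move=> surj kerE hf hg f0 g0; pose cst : {rmorphism tower F d -> _} := polyC \o (@polyC (tower F d)).
pose theta : {rmorphism tower F d -> C} := Theta \o cst.
pose phi : {rmorphism F -> C} := theta \o tC F d.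
pose a i := Theta (tX F d.+2 i); pose y i := theta (tX F d i).
have aE : teval phi a d.+2 =1 Theta.
  apply: (@tower_ext F C d.+2 _ Theta) => [c|i lti]; first by rewrite tevalC.
  by rewrite tevalX.
have yE : teval phi y d =1 theta.
  apply: tower_ext => [c|i lti]; first by rewrite tevalC.
  by rewrite tevalX.
have span := finite_quotient surj hf hg f0 g0.
have [h [mh h0]] := finite_integral (theta := theta) (Theta 'X%:P) span.
have hE : Theta h%:P = 0.
  rewrite -h0 (map_poly_comp Theta cst) horner_map; congr (Theta _).
  have -> : map_poly cst h = map_poly polyC (map_poly polyC h) by rewrite map_poly_comp.
  by rewrite horner_map -[_.['X]]/(_ \Po 'X) comp_polyXr.
apply: (@CM_of_finite_flat F C phi d.+2 d _ a y _ _ _ _).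
- by move=> z; have [x <-] := surj z; exists x; apply: aE.
- move=> z; have [b ->] := span z; exists b; apply: eq_bigr => u _.
  by rewrite yE.
move=> s ws; rewrite (eq_map yE).
exact: (determinantal_flat surj kerE (monic_Xn_lower hf) mh f0 hE ws).
Qed.

End CMDeterminantal.

(** * Leading forms of the iterated cross products *)

Section LeadingForms.
Local Open Scope ring_scope.

(** Components are indexed cyclically, which makes the cross product and the
    pattern of the leading forms uniform. *)
Definition ix (n : nat) : 'I_3 := inord (n %% 3)%N.

Lemma ord3_ix (c : 'I_3) : c = ix c.
Proof. by apply/val_inj; rewrite /= inordK ?modn_small. Qed.

Lemma ix0 : ix 0 = 0. Proof. by apply/val_inj; rewrite /= inordK. Qed.
Lemma ix1 : ix 1 = 1. Proof. by apply/val_inj; rewrite /= inordK. Qed.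
Lemma ix2 : ix 2 = 2%:R. Proof. by apply/val_inj; rewrite /= inordK. Qed.

Lemma ix_add3 n : ix n.+3 = ix n. Proof. by congr inord; rewrite -addn3 modnDr. Qed.

Lemma crossmul_ix (R : comNzRingType) (a b : 'rV[R]_3) n :
  crossmul a b 0 (ix n) =
    a 0 (ix n.+1) * b 0 (ix n.+2) - a 0 (ix n.+2) * b 0 (ix n.+1).
Proof.
elim/ltn_ind: n => -[|[|[|n]]] IH; last first.
  have lt : (n < n.+3)%N by lia.
  by rewrite ix_add3 (IH n lt) (ix_add3 n.+1) (ix_add3 n.+2).
- by rewrite (ix_add3 0) (ix_add3 1) ix0 ix1 ix2 mxE.
- by rewrite (ix_add3 0) ix0 ix1 ix2 mxE.
- by rewrite ix0 ix1 ix2 mxE.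
Qed.

(** A vector with entries [x], [y], [0] in cyclic order, starting at index [n]. *)
Definition lead_form (R : comNzRingType) (x y : R) (n : nat) (c : 'I_3) : R :=
  if c == ix n then x else if c == ix n.+1 then y else 0.

Lemma eq_ix m n : (ix m == ix n) = (m == n %[mod 3])%N.
Proof. by rewrite -val_eqE /= !inordK ?ltn_mod. Qed.

Lemma ix_neq1 n : (ix n.+1 == ix n) = false.
Proof. by rewrite eq_ix; apply/eqP; lia. Qed.

Lemma ix_neq2 n : (ix n.+2 == ix n) = false.
Proof. by rewrite eq_ix; apply/eqP; lia. Qed.

Section Invariant.
Variable B : comNzRingType.
Local Notation R := {poly {poly B}}.
Local Notation X := ('X : R).
Local Notation Y := ('X%:P : R).
Implicit Types (u v w : 'rV[R]_3).

Definition sign_elt (e : R) := e = 1 \/ e = -1.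

Lemma sign_eltM e e' : sign_elt e -> sign_elt e' -> sign_elt (e * e').
Proof.
by move=> [->|->] [->|->]; rewrite ?mulN1r ?mul1r ?opprK; [left|right|right|left].
Qed.

Lemma sign_sqr e : sign_elt e -> e * e = 1.
Proof. by move=> [->|->]; rewrite ?mulr1 ?mulrNN ?mulr1. Qed.

Lemma deg_lt1 : deg_lt 1 (1 : R). Proof. exact: (deg_lt_cst 1). Qed.

Lemma deg_lt_sign e : sign_elt e -> deg_lt 1 e.
Proof. by case=> ->; [|apply: deg_ltN]; apply: deg_lt1. Qed.

(** Up to signs, one component has leading form [X^j] and another one [Y^j]
    modulo [X]; so the leading forms have no common zero other than the origin.  The indices of the two components move
    by two, cyclically, when [j] increases by one. *)
Definition lead_inv (j : nat) (w : 'rV[R]_3) :=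
  exists e1 e2 r, [/\ sign_elt e1 /\ sign_elt e2, deg_lt j r,
    deg_lt j (w 0 (ix (2 * j)) - e1 * X ^+ j),
    deg_lt j (w 0 (ix (2 * j).+1) - e2 * (Y ^+ j + X * r))
  & forall c, deg_lt j.+1 (w 0 c)].

Lemma Smx_entry w c : exists2 e, sign_elt e & (w *m Smx R) 0 c = e * w 0 c.
Proof.
exists (row3 (-1) (-1) 1 0 c : R).
  by rewrite mxE; case: c => -[|[|[|]]] //= _; [right|right|left].
by rewrite /Smx mul_mx_diag mxE mulrC.
Qed.

(** [S] only changes signs. *)
Lemma lead_inv_S j w : lead_inv j w -> lead_inv j (w *m Smx R).
Proof.
move=> [e1 [e2 [r [[se1 se2] hr h1 h2 hw]]]].
have [s1 ss1 E1] := Smx_entry w (ix (2 * j)).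
have [s2 ss2 E2] := Smx_entry w (ix (2 * j).+1).
exists (s1 * e1), (s2 * e2), r; split=> //; first by split; apply: sign_eltM.
- by rewrite E1 -mulrA -mulrBr; apply: (@deg_ltM _ 0 j) => //; apply: deg_lt_sign.
- by rewrite E2 -mulrA -mulrBr; apply: (@deg_ltM _ 0 j) => //; apply: deg_lt_sign.
by move=> c; have [s ss ->] := Smx_entry w c; apply: (@deg_ltM _ 0 j.+1) => //; apply: deg_lt_sign.
Qed.

(** The leading form of [v] has entries [X], [Y], [0] at the indices [2 j + 1],
    [2 j + 2], [2 j].  The vanishing entry reduces the component [2 j + 2] of the
    product to [X] times the component [2 j] of [u], that is [X^(j+1)]; and the
    component [2 j] is [Y] times the component [2 j + 1] of [u] modulo [X], that
    is [Y^(j+1)]. *)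
Lemma lead_inv_cross j u v : (forall c, deg_lt 1 (v 0 c - lead_form X Y (2 * j).+1 c)) ->
  lead_inv j u -> lead_inv j.+1 (crossmul u v).
Proof.
move=> hv [e1 [e2 [r [[se1 se2] hr h1 h2 hu]]]].
have de1 := deg_lt_sign se1; have de2 := deg_lt_sign se2.
have i3 : ix (2 * j).+3 = ix (2 * j) by exact: ix_add3.
have v1 : deg_lt 1 (v 0 (ix (2 * j).+1) - X).
  by have := hv (ix (2 * j).+1); rewrite /lead_form eqxx.
have v2 : deg_lt 1 (v 0 (ix (2 * j).+2) - Y).
  by have := hv (ix (2 * j).+2); rewrite /lead_form ix_neq1 eqxx.
have v0 : deg_lt 1 (v 0 (ix (2 * j))).
  have := hv (ix (2 * j)); rewrite -i3 /lead_form ix_neq2 ix_neq1.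
  by rewrite subr0.
have dv c : deg_lt 2 (v 0 c).
  rewrite -[v 0 c](subrK (lead_form X Y (2 * j).+1 c)); apply: deg_ltD.
    exact: deg_lt_le (hv c).
  rewrite /lead_form; case: ifP => _; first exact: deg_ltX.
  by case: ifP => _; [exact: deg_ltY|exact: deg_lt0].
have hc n : deg_lt j.+2 (crossmul u v 0 (ix n)).
  rewrite crossmul_ix; apply: deg_ltB; rewrite mulrC; exact: (@deg_ltM _ 1 j.+1).
have W1 : crossmul u v 0 (ix (2 * j).+2) =
    u 0 (ix (2 * j)) * v 0 (ix (2 * j).+1) - u 0 (ix (2 * j).+1) * v 0 (ix (2 * j)).
  by rewrite crossmul_ix i3 (ix_add3 (2 * j).+1).
have W2 : crossmul u v 0 (ix (2 * j)) =
    u 0 (ix (2 * j).+1) * v 0 (ix (2 * j).+2) - u 0 (ix (2 * j).+2) * v 0 (ix (2 * j).+1).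
  by rewrite crossmul_ix.
move: (u 0 (ix (2 * j))) (u 0 (ix (2 * j).+1)) (u 0 (ix (2 * j).+2)) (hu (ix (2 * j)))
  (hu (ix (2 * j).+1)) (hu (ix (2 * j).+2)) W1 W2 h1 h2 => U0 U1 U2 hU0 hU1 hU2 W1 W2 h1 h2.
move: (v 0 (ix (2 * j))) (v 0 (ix (2 * j).+1)) (v 0 (ix (2 * j).+2)) (dv (ix (2 * j)))
  (dv (ix (2 * j).+1)) (dv (ix (2 * j).+2)) v0 v1 v2 W1 W2
  => V0 V1 V2 dV0 dV1 dV2 v0 v1 v2 W1 W2.
have dX := @deg_ltXn B j _ (@deg_ltX B); have dY := @deg_ltXn B j _ (@deg_ltY B).
exists e1, e2, (r * Y - e2 * U2).
have e2j : (2 * j.+1 = (2 * j).+2)%N by lia.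
split=> //.
- apply: deg_ltB.
    by rewrite -addn1 addnC mulrC; apply: (@deg_ltM _ 1 j) => //; apply: deg_ltY.
  exact: (@deg_ltM _ 0 j.+1).
- rewrite e2j W1.
  rewrite (_ : _ - _ = V1 * (U0 - e1 * X ^+ j) + (e1 * (X ^+ j * (V1 - X)) - V0 * U1)); last first.
    by rewrite exprS; ring.
  apply: deg_ltD; first exact: (@deg_ltM _ 1 j).
  apply: deg_ltB; last exact: (@deg_ltM _ 0 j.+1).
  apply: (@deg_ltM _ 0 j.+1) => //; rewrite -addn1; exact: (@deg_ltM _ j 1).
- rewrite e2j i3 W2.
  (* The new remainder carries [- e2 * U2], so the sign must square to [1]. *)
have sq : U2 = e2 * e2 * U2 by rewrite sign_sqr ?mul1r.
  have -> : U1 * V2 - U2 * V1 - e2 * (Y ^+ j.+1 + X * (r * Y - e2 * U2)) =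
     V2 * (U1 - e2 * (Y ^+ j + X * r)) + (e2 * ((Y ^+ j + X * r) * (V2 - Y)) - (V1 - X) * U2).
    by rewrite [in LHS](_ : U2 * V1 = (V1 - X) * U2 + X * (e2 * e2 * U2)); [rewrite exprS; ring|rewrite -sq; ring].
  apply: deg_ltD; first exact: (@deg_ltM _ 1 j).
  apply: deg_ltB; last exact: (@deg_ltM _ 0 j.+1).
  apply: (@deg_ltM _ 0 j.+1) => //; rewrite -addn1; apply: (@deg_ltM _ j 1) => //.
  by apply: deg_ltD => //; apply: (@deg_ltM _ 1 j) => //; apply: deg_ltX.
by move=> c; rewrite (ord3_ix c).
Qed.

(** The vector [v_1] plays the role of the first member of the recursion. *)
Lemma lead_inv_wvec (v : nat -> 'rV[R]_3) k :
    (forall c, deg_lt 1 (v 1%N 0 c - lead_form X Y 2 c)) ->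
    (forall j c, (1 < j <= k)%N -> deg_lt 1 (v j 0 c - lead_form X Y (2 * j).+2 c)) ->
  forall j, (1 < j <= k)%N -> lead_inv j (wvec v j).
Proof.
move=> h1 hv; have hv' j : (0 < j < k)%N ->
    forall c, deg_lt 1 (v j.+1 0 c - lead_form X Y (2 * j).+1 c).
  move=> hj c; have -> : lead_form X Y (2 * j).+1 c = lead_form X Y (2 * j.+1).+2 c.
    have -> : (2 * j.+1).+2 = (2 * j).+1.+3 by lia.
    by rewrite /lead_form ix_add3 (ix_add3 (2 * j).+2).
  exact: hv.
have inv1 : lead_inv 1 (v 1%N).
  have l2 : lead_form X Y 2 (ix 2) = X by rewrite /lead_form eqxx.
  have l3 : lead_form X Y 2 (ix 3) = Y by rewrite /lead_form ix_neq1 eqxx.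
  exists 1, 1, 0; split; first by split; left.
  - exact: deg_lt0.
  - by rewrite mul1r expr1 -l2; apply: h1.
  - by rewrite mul1r expr1 mulr0 addr0 -l3; apply: h1.
  move=> c; rewrite -[v _ _ c](subrK (lead_form X Y 2 c)); apply: deg_ltD.
    exact: deg_lt_le (h1 c).
  rewrite /lead_form; case: ifP => _; first exact: deg_ltX.
  by case: ifP => _; [exact: deg_ltY|exact: deg_lt0].
elim=> // -[//|[|j]] IH hj; first exact: (lead_inv_cross (hv' 1%N _) inv1).
apply: lead_inv_cross; first by apply: hv'; lia.
by apply/lead_inv_S/IH; lia.
Qed.

End Invariant.

Lemma deg_lt_exp (B : comNzRingType) m n (p : {poly {poly B}}) :
  deg_lt m.+1 p -> deg_lt (m * n).+1 (p ^+ n).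
Proof.
move=> hp; elim: n => [|n IH]; first by rewrite muln0; apply: deg_lt1.
by rewrite exprS mulnS -addnS; apply: deg_ltM.
Qed.

(** The power of [Y] comes from the factorization of [(Y^k)^k - (- X r)^k],
    in which [X^k] may be replaced by terms of lower degree. *)
Lemma lead_inv_powers (B C : comNzRingType) (Theta : {rmorphism {poly {poly B}} -> C})
    k (w : 'rV[{poly {poly B}}]_3) :
    lead_inv k w -> (0 < k)%N -> (forall c, Theta (w 0 c) = 0) ->
  exists f g, [/\ deg_lt k f, deg_lt (k * k) g, Theta ('X ^+ k + f) = 0
                & Theta ('X%:P ^+ (k * k) + g) = 0].
Proof.
case: k => // k [e1 [e2 [r [[se1 se2] hr h1 h2 _]]]] _ w0.
move: (w 0 (ix (2 * k.+1))) (w 0 (ix (2 * k.+1).+1)) h1 h2 (w0 (ix (2 * k.+1))) (w0 (ix (2 * k.+1).+1)) => W1 W2 h1 h2 W10 W20.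
pose f := e1 * (W1 - e1 * 'X ^+ k.+1); pose l := e2 * (W2 - e2 * ('X%:P ^+ k.+1 + 'X * r)).
have df : deg_lt k.+1 f by apply: (@deg_ltM _ 0 k.+1) => //; apply: deg_lt_sign.
have dl : deg_lt k.+1 l by apply: (@deg_ltM _ 0 k.+1) => //; apply: deg_lt_sign.
have fE : 'X ^+ k.+1 + f = e1 * W1 by rewrite /f mulrBr mulrA sign_sqr // mul1r addrC subrK.
have lE : 'X%:P ^+ k.+1 + 'X * r + l = e2 * W2.
  by rewrite /l mulrBr mulrA sign_sqr // mul1r addrC subrK.
pose Q := \sum_(i < k.+1) ('X%:P ^+ k.+1) ^+ (k - i) * (- ('X * r)) ^+ i.
have dQ : deg_lt (k.+1 * k).+1 Q.
  apply: (big_ind (deg_lt (k.+1 * k).+1)) => [||i _]; first exact: deg_lt0.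
    exact: deg_ltD.
  have -> : ((k.+1 * k).+1 = k.+1 * (k - i) + (k.+1 * i).+1)%N.
    by rewrite addnS -mulnDr subnK // -ltnS.
  apply: (@deg_ltM _ _ _ _ _ _ _).
    by apply: deg_lt_exp; apply: deg_ltXn; apply: deg_ltY.
  by apply: deg_lt_exp; apply: deg_ltN; apply: (@deg_ltM _ 1 k.+1) => //; apply: deg_ltX.
exists f, (Q * l + (- r) ^+ k.+1 * f); split=> //.
- apply: deg_ltD.
    have -> : (k.+1 * k.+1 = k.+1 * k + k.+1)%N by rewrite mulnS addnC.
    exact: deg_ltM.
  have -> : (k.+1 * k.+1 = k * k.+1 + k.+1)%N by rewrite mulSn addnC.
  by apply: deg_ltM => //; apply: deg_lt_exp; apply: deg_ltN.
- by rewrite fE rmorphM W10 mulr0.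
have e : ('X%:P ^+ k.+1) ^+ k.+1 - (- ('X * r)) ^+ k.+1 = ('X%:P ^+ k.+1 + 'X * r) * Q.
  by rewrite subrXX opprK.
have -> : 'X%:P ^+ (k.+1 * k.+1) + (Q * l + (- r) ^+ k.+1 * f) =
    (('X%:P ^+ k.+1) ^+ k.+1 - (- ('X * r)) ^+ k.+1) + Q * l + (- r) ^+ k.+1 * ('X ^+ k.+1 + f).
  rewrite exprM (_ : - ('X * r) = (- r) * 'X); last by ring.
  by rewrite exprMn; ring.
rewrite e (_ : _ + Q * l = Q * ('X%:P ^+ k.+1 + 'X * r + l)); last by ring.
by rewrite fE lE rmorphD !rmorphM W10 W20 !mulr0 addr0.
Qed.

End LeadingForms.

(** * Adapted coordinates and the conclusion *)

Section Naturality.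
Local Open Scope ring_scope.
Variables (R T : comNzRingType) (f : {rmorphism R -> T}).

Lemma map_crossmul (a b : 'rV[R]_3) :
  map_mx f (crossmul a b) = crossmul (map_mx f a) (map_mx f b).
Proof.
apply/rowP => c; rewrite (ord3_ix c) mxE !crossmul_ix !mxE.
by rewrite rmorphB !rmorphM.
Qed.

Lemma map_Smx : map_mx f (Smx R) = Smx T.
Proof.
apply/matrixP => i j; rewrite !mxE rmorphMn; congr (_ *+ _).
by case: i => -[|[|[|]]] //= _; rewrite ?rmorphN rmorph1.
Qed.

Lemma map_wvec (v : nat -> 'rV[R]_3) j :
  map_mx f (wvec v j) = wvec (fun i => map_mx f (v i)) j.
Proof.
elim: j => [|[|[|j]] IH]; rewrite ?map_mx0 //; first exact: map_crossmul.
by rewrite [wvec v _]/= map_crossmul map_mxM map_Smx IH.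
Qed.

Lemma map_lead_form (x y : R) n c :
  f (lead_form x y n c) = lead_form (f x) (f y) n c.
Proof. by rewrite /lead_form; do 2?[case: ifP => // _]; rewrite rmorph0. Qed.
End Naturality.

Section ChangeOfVariables.
Local Open Scope ring_scope.
Variables (F : fieldType) (n : nat) (qx qy : 'I_n).

Definition other_vars := [seq q <- enum 'I_n | (q != qx) && (q != qy)].
Local Notation d := (size other_vars).
Local Notation R := {poly {poly tower F d}}.
Local Notation X := ('X : R).
Local Notation Y := ('X%:P : R).

(* The form in [x] and [y] to which the variable [q] specializes when the new
   parameters are set to zero; it is given over all rings because it is needed
   on both sides of the change of variables. *)
Variable lam : forall T : comNzRingType, T -> T -> 'I_n -> T.
Hypothesis lam_nat : forall (T U : comNzRingType) (f : {rmorphism T -> U}) x y q,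
  f (lam x y q) = lam (f x) (f y) q.
Hypothesis lam_qx : forall (T : comNzRingType) (x y : T), lam x y qx = x.
Hypothesis lam_qy : forall (T : comNzRingType) (x y : T), lam x y qy = y.

(** Adding to each variable other than [qx] and [qy] a form in these two is a
    triangular, hence invertible, change of variables. *)
Lemma other_vars_iso : exists (Phi : {rmorphism {mpoly F[n]} -> R})
    (Psi : {rmorphism R -> {mpoly F[n]}}),
  [/\ cancel Phi Psi, cancel Psi Phi
    & forall q, deg_lt 1 (Phi 'X_q - lam X Y q)].
Proof.
pose par (i : nat) : R := (tX F d i)%:P%:P.
pose new q : R := lam X Y q + (if (q == qx) || (q == qy) then 0 else par (index q other_vars)).
have newx : new qx = X by rewrite /new eqxx lam_qx addr0.
have newy : new qy = Y by rewrite /new eqxx orbT lam_qy addr0.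
have [Phi [PhiX PhiC]] : exists Phi : {rmorphism {mpoly F[n]} -> R},
    (forall q, Phi 'X_q = new q) /\ (forall c, Phi c%:MP = tC F d.+2 c).
  exists (mmap (tC F d.+2) new); split=> [q|c] /=; last by rewrite mmapC.
  by rewrite mmapX mmap1U.
pose old i : {mpoly F[n]} := if (i < d)%N then
    'X_(nth qx other_vars i) - lam 'X_qx 'X_qy (nth qx other_vars i)
  else if i == d then 'X_qy else 'X_qx.
have oldx : old d.+1 = 'X_qx by rewrite /old ltnNge leqnSn /= gtn_eqF.
have oldy : old d = 'X_qy by rewrite /old ltnn eqxx.
have [Psi [PsiC PsiX PsiY PsiP]] : exists Psi : {rmorphism R -> {mpoly F[n]}},
    [/\ forall c, Psi (tC F d.+2 c) = c%:MP, Psi X = 'X_qx, Psi Y = 'X_qy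
      & forall i, (i < d)%N -> Psi (par i) = old i].
  exists (teval (@mpolyC n F) old d.+2).
  have PX := fun i => @tevalX F _ (@mpolyC n F) old d.+2 i; split=> [c|||i lti].
  - exact: (tevalC _ _ d.+2).
  - by have := PX d.+1 (ltnSn _); rewrite /= eqxx oldx.
  - by have := PX d (ltnW (ltnSn _)); rewrite /= ltn_eqF // eqxx oldy.
  - by have := PX i (leqW (leqW lti)); rewrite /= !ltn_eqF // leqW.
exists Phi, Psi; split.
- move=> p; rewrite [p]mpolyE !rmorph_sum; apply: eq_bigr => m _.
  rewrite -mul_mpolyC !rmorphM PhiC PsiC; congr (_ * _).
  rewrite mpolyXE_id !rmorph_prod; apply: eq_bigr => q _.
  rewrite !rmorphXn; congr (_ ^+ _); rewrite PhiX /new rmorphD lam_nat PsiX PsiY.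
  case: ifP => [/orP[/eqP->|/eqP->]|ne].
  + by rewrite lam_qx rmorph0 addr0.
  + by rewrite lam_qy rmorph0 addr0.
  have oq : q \in other_vars by rewrite mem_filter -negb_or ne mem_enum.
  have lti : (index q other_vars < d)%N by rewrite index_mem.
  by rewrite PsiP // /old lti nth_index // addrC subrK.
- pose f : {rmorphism R -> R} := Phi \o Psi; pose g : {rmorphism R -> R} := idfun.
  apply: (@tower_ext F R d.+2 f g) => [c|i]; first by rewrite /f /= (PsiC c) PhiC.
  rewrite !ltnS leq_eqVlt => /orP[/eqP->|].
    by rewrite /f /g /= eqxx PsiX PhiX newx.
  rewrite ltnS leq_eqVlt => /orP[/eqP->|lti].
    by rewrite /f /g /= ltn_eqF // eqxx PsiY PhiX newy.
  rewrite /f /g /= !ltn_eqF //; last exact: leqW.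
  rewrite -/(par i) PsiP // /old lti rmorphB lam_nat !PhiX newx newy /new.
  set q := nth _ _ _; have oq : q \in other_vars by apply: mem_nth.
  have := oq; rewrite mem_filter -negb_or => /andP[/negbTE-> _].
  have uo : uniq other_vars by apply: filter_uniq; exact: enum_uniq.
  by rewrite index_uniq // addrC addKr.
move=> q; rewrite PhiX /new addrC addKr; case: ifP => _; first exact: deg_lt0.
exact: deg_lt_cst.
Qed.

End ChangeOfVariables.

Section Main.
Local Open Scope ring_scope.
Variables (F : fieldType) (k : nat).

(** Row [i] is the pattern of the vector [v_(i+1)].  For [v_(i+1)] with [i > 0]
    the pattern starts at [2 (i + 1) + 2], which is [2 i + 1] modulo 3, as
    required by the step from [i] to [i + 1]; for [v_1] it starts at [2], so that
    [X] and [Y] themselves are entries of [v_1]. *)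
Definition lead_matrix (T : comNzRingType) (x y : T) : 'M[T]_(k, 3) :=
  \matrix_(i, c) lead_form x y (if i == 0%N :> nat then 2 else (2 * i.+1).+2) c.

Definition lead_var (T : comNzRingType) (x y : T) (q : 'I_(k * 3)) : T :=
  mxvec (lead_matrix x y) 0 q.

Lemma lead_varE (T : comNzRingType) (x y : T) i c :
  lead_var x y (mxvec_index i c) =
    lead_form x y (if i == 0%N :> nat then 2 else (2 * i.+1).+2) c.
Proof. by rewrite /lead_var mxvecE mxE. Qed.

Lemma lead_var_nat (T U : comNzRingType) (f : {rmorphism T -> U}) x y q :
  f (lead_var x y q) = lead_var (f x) (f y) q.
Proof.
by case/mxvec_indexP: q => i c; rewrite !lead_varE map_lead_form.
Qed.

Lemma vvec_entry i c (lti : (i < k)%N) :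
  vvec F k i.+1 0 c = 'X_(mxvec_index (Ordinal lti) c).
Proof. by rewrite /vvec insubT mxE. Qed.

Lemma pi_eq0 z : \pi_(RmodI F k)%qT z = 0 <-> z \in @Ik F k.
Proof.
rewrite -[X in X \in _]subr0 Quotient.idealrBE -(rmorph0 (\pi_(RmodI F k)%qT)).
by split=> /eqP.
Qed.

Lemma wvec_crossmul (R : comNzRingType) (v : nat -> 'rV[R]_3) :
  (1 < k)%N -> exists u, wvec v k = crossmul u (v k).
Proof.
case: k => [|[|[|j]]] // _; first by exists (v 1%N).
by exists (wvec v j.+2 *m Smx R).
Qed.

Theorem cohen_macaulay_RmodI : (1 < k)%N -> cohen_macaulay (RmodI F k).
Proof.
move=> k_gt1; have k_gt0 : (0 < k)%N := ltnW k_gt1.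
pose i0 := Ordinal k_gt0.
pose qx := mxvec_index i0 (ix 2); pose qy := mxvec_index i0 (ix 3).
have lam_qx (T : comNzRingType) (x y : T) : lead_var x y qx = x.
  by rewrite lead_varE /lead_form eqxx.
have lam_qy (T : comNzRingType) (x y : T) : lead_var x y qy = y.
  by rewrite lead_varE /lead_form ix_neq1 eqxx.
have [Phi [Psi [PhiK PsiK PhiX]]] := @other_vars_iso F _ qx qy _ lead_var_nat lam_qx lam_qy.
pose v j := map_mx Phi (vvec F k j).
have wE : wvec v k = map_mx Phi (wvec (vvec F k) k) by rewrite map_wvec.
have inv : lead_inv k (wvec v k).
  have hv i (lti : (i < k)%N) c : deg_lt 1 (v i.+1 0 c -
      lead_form 'X 'X%:P (if i == 0%N :> nat then 2 else (2 * i.+1).+2) c).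
    by rewrite mxE (vvec_entry _ lti) -(lead_varE _ _ (Ordinal lti)).
  apply: (@lead_inv_wvec _ v k) => [c|[|[|j]] c|] //; first exact: (hv 0%N).
    by move=> /andP[_ ltj]; apply: (hv j.+1).
  by rewrite k_gt1 leqnn.
pose Theta : {rmorphism {poly {poly tower F (size (other_vars qx qy))}} -> RmodI F k} :=
  \pi_(RmodI F k)%qT \o Psi.
have memw c : wvec (vvec F k) k 0 c \in @Ik F k.
  by apply/mem_ideal_gen/map_f; rewrite mem_enum.
have w0 c : Theta (wvec v k 0 c) = 0.
  by rewrite wE mxE /Theta /= PhiK; apply/pi_eq0.
have [f [g [hf hg f0 g0]]] := lead_inv_powers inv k_gt0 w0.
have [u uE] := wvec_crossmul v k_gt1.
apply: (@CM_determinantal F _ _ Theta (u 0 0) (u 0 1) (u 0 2%:R) (v k 0 0) (v k 0 1)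
    (v k 0 2%:R) f g k (k * k)) => //.
  by move=> z; exists (Phi (repr z)); rewrite /Theta /= PhiK reprK.
move=> x.
have w_0 := crossmul_ix u (v k) 0; have w_1 := crossmul_ix u (v k) 1.
have w_2 := crossmul_ix u (v k) 2; move: w_0 w_1 w_2.
rewrite (ix_add3 0) (ix_add3 1) ix0 ix1 ix2 -uE => <- <- <-.
split=> [/pi_eq0|[c1 [c2 [c3 ->]]]]; last first.
  by rewrite !rmorphD !rmorphM !w0 !mulr0 !addr0.
rewrite /= -{2}(PsiK x); move: (Psi x) => z.
apply: (@ideal_gen_min _ (fun z => exists c1 c2 c3, Phi z =
    c1 * wvec v k 0 0 + c2 * wvec v k 0 1 + c3 * wvec v k 0 2%:R)).
  split; first by exists 0, 0, 0; rewrite rmorph0; ring.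
  move=> a y t [c1 [c2 [c3 e]]] [d1 [d2 [d3 e']]].
  exists (Phi a * c1 + d1), (Phi a * c2 + d2), (Phi a * c3 + d3).
  by rewrite rmorphD rmorphM e e'; ring.
move=> _ /mapP[c _ ->]; rewrite wE !mxE.
case: c => -[|[|[|]]] //= lt3.
- by exists 1, 0, 0; rewrite mul1r !mul0r !addr0; congr (Phi (_ 0 _)); apply: val_inj.
- by exists 0, 1, 0; rewrite mul1r !mul0r add0r addr0; congr (Phi (_ 0 _)); apply: val_inj.
- by exists 0, 0, 1; rewrite mul1r !mul0r !add0r; congr (Phi (_ 0 _)); apply: val_inj.
Qed.

End Main.

Theorem theorem31 (F : fieldType) (hF : 2%N \notin [pchar F]%R)
  (k : nat) (hk : 2 <= k) : cohen_macaulay (RmodI F k).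
Proof. exact: cohen_macaulay_RmodI. Qed.
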